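(* Let $A_1,\ldots,A_m\in\mathbb{R}^{n\times n}$. The switched linear system $\dot x=A_i x$, $i\in\{1,\ldots,m\}$, is asymptotically stable under arbitrary switching if and only if there exists a (common) homogeneous polynomial $W:\mathbb{R}^n\to\mathbb{R}$ such that $W$ is a sum of squares and, for every $i=1,\ldots,m$, the polynomial $-\dot W_i(x)=-\langle\nabla W(x),A_i x\rangle$ is a sum of squares, where the polynomials $W$ and $-\dot W_1,\ldots,-\dot W_m$ are all positive definite.
   Context: A function $V:\mathbb{R}^n\to\mathbb{R}$ is positive definite if $V(x)>0$ for all $x\neq 0$. A polynomial is a sum of squares (sos) if it equals $\sum_i q_i^2$ for finitely many real polynomials $q_i$. A polynomial $V$ of degree $d$ is homogeneous if $V(\lambda x)=\lambda^dV(x)$ for every $\lambda\in\mathbb{R}$. In the switched system, the active matrix may be switched arbitrarily in time, with the time between consecutive switches bounded away from zero so that solutions are well defined. (Global) asymptotic stability under arbitrary switching is equivalent to, and is here taken to mean, asymptotic stability of the linear differential inclusion $\dot x\in \mathrm{co}\{A_1,\ldots,A_m\}x$, where $\mathrm{co}$ denotes the convex hull: for every $\varepsilon>0$ there is $\delta>0$ such that every absolutely continuous solution $x:[0,\infty)\to\mathbb{R}^n$ with $\|x(0)\|<\delta$ satisfies $\|x(t)\|<\varepsilon$ for all $t\ge 0$, and every solution satisfies $x(t)\to 0$ as $t\to\infty$. *)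

(* Defs.v *)
(* The notations of mpoly are not imported, since they clash
   with those of MathComp-Analysis. *)
From HB Require Import structures.
From mathcomp Require Import all_boot all_order all_algebra.
From mathcomp Require Import all_classical all_reals all_analysis.
From mathcomp Require Import (canonicals, coercions) mpoly.

Set Implicit Arguments.
Unset Strict Implicit.
Unset Printing Implicit Defensive.

Import Order.TTheory GRing.Theory Num.Theory numFieldNormedType.Exports.

Local Open Scope classical_set_scope.
Local Open Scope ring_scope.

Section Polynomials.
Variables (R : realType) (n : nat).
Implicit Types (p : mpoly.mpoly n R) (x : 'cV[R]_n) (M : 'M[R]_n).

Definition poly_eval p x : R := mpoly.meval (fun i => x i ord0) p.

Definition positive_definite p := forall x, x != 0 -> 0 < poly_eval p x.

Definition sum_of_squares p :=
  exists qs : seq (mpoly.mpoly n R), p = \sum_(q <- qs) q ^+ 2.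

Definition poly_degree p : nat := (mpoly.mmeasure (@mpoly.mdeg n) p).-1.

Definition homogeneous p := forall (lambda : R) x,
  poly_eval p (lambda *: x) = lambda ^+ poly_degree p * poly_eval p x.

(* The j-th coordinate of the linear vector field x |-> M x, as a polynomial. *)
Definition linear_field M (j : 'I_n) : mpoly.mpoly n R :=
  \sum_k M j k *: mpoly.mpolyX R (mpoly.mnm1 k).

(* The polynomial <grad p (x), M x>. *)
Definition lie_derivative M p : mpoly.mpoly n R :=
  \sum_j mpoly.mderiv j p * linear_field M j.

End Polynomials.

Section Inclusion.
Variable R : realType.

Definition convex_hull (V : lmodType R) (S : set V) : set V :=
  smallest (@convex_set R V) S.

Definition absolutely_continuous_on (V : normedModType R) (f : R -> V)
    (a b : R) :=
  forall e : R, 0 < e -> exists2 d : R, 0 < d &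
    forall (N : nat) (u v : 'I_N -> R),
      (forall i, a <= u i /\ u i <= v i /\ v i <= b) ->
      trivIset setT (fun i => `]u i, v i[%classic) ->
      \sum_i (v i - u i) < d ->
      \sum_i `|f (v i) - f (u i)| < e.

(* On the unbounded interval [0, +oo[ absolute continuity is understood, as
   usual for Caratheodory solutions, on every compact subinterval: the uniform
   version would exclude exponentially growing trajectories. Only the values of
   x on [0, +oo[ matter. *)
Definition inclusion_solution (n m : nat) (A : 'I_m -> 'M[R]_n)
    (x : R -> 'cV[R]_n) :=
  (forall T : R, 0 < T -> absolutely_continuous_on x 0 T) /\
  {ae (@lebesgue_measure R), forall t : R, 0 < t ->
     exists2 M, convex_hull (range A) M & is_derive t 1 x (M *m x t)}.

(* The norm on 'cV[R]_n is the maximum norm; by equivalence of norms the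
   property is that obtained with the Euclidean norm. *)
Definition asymptotically_stable (n m : nat) (A : 'I_m -> 'M[R]_n) :=
  (forall e : R, 0 < e -> exists2 d : R, 0 < d &
     forall x, inclusion_solution A x -> `|x 0| < d ->
       forall t : R, 0 <= t -> `|x t| < e) /\
  (forall x, inclusion_solution A x -> x t @[t --> +oo] --> (0 : 'cV[R]_n)).

End Inclusion.

(* Main.v *)
Require Import Defs.
From HB Require Import structures.
From mathcomp Require Import all_boot all_order all_algebra.
From mathcomp Require Import all_classical all_reals all_analysis.
From mathcomp Require Import (canonicals, coercions) mpoly.
From mathcomp Require Import measurable_realfun.
From mathcomp Require Import ring lra.

(** A polynomial certificate is sufficient by Lyapunov's argument. Along a
    solution x, the function W (x t) is absolutely continuous and its
    derivative is, almost everywhere, the value at x t of the Lie derivative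
    of W along a matrix of the convex hull. That value is at most - c W (x t):
    on the unit sphere the bound for each A_i follows from compactness, it
    extends to all vectors by homogeneity, and it passes to the convex hull
    because the Lie derivative is linear in the matrix [decay_rate]. Hence
    (1 + c t) W (x t) has a nonpositive derivative almost everywhere, so it is
    nonincreasing [ac_nonincreasing], and W (x t) <= W (x 0) / (1 + c t). This
    gives stability and attractivity at once [lyapunov_stable]. The rate
    1 / (1 + c t) is worse than exponential but avoids any multiplier other
    than a polynomial in t.

    The converse could be obtained by smoothing a norm, approximating it by a
    polynomial and invoking a Positivstellensatz to make everything a sum of
    squares. The proof below is more elementary, since a suitable form of the
    Lyapunov function makes the sums of squares explicit.

    - Stability gives a common bound on all products of exponentials
      exp (h_1 A_i1) ... exp (h_k A_ik), because these are values of solutions.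
      If such products over long times were not uniformly small, a compactness
      argument would produce one switching sequence whose trajectory does not
      tend to 0 [uniform_decay].
    - Replacing exp (h A_i) by its first-order approximation B_i = 1 + h A_i
      costs o(h) per step, hence o(1) over a bounded time. So for some h > 0 and
      some length L all products of L of the B_i are small [contractive_euler].
    - Take as linear forms y_j all the rows of all the shorter products of the
      B_i, the rows of a product of length l being divided by rho ^ l. Then
      y_j B_i = sum_k mu_ijk y_k with sum_k |mu_ijk| <= rho < 1, so that
      max_j |y_j| is a polyhedral norm contracted by each B_i
      [common_polynomial_of_contractive].
    - Let W = sum_j y_j ^ q with q a large power of 2. Up to a positive factor,
      the derivative of - W along A_i is
      sum_j y_j ^ (q - 1) (y_j - sum_k mu_ijk y_k). The arithmetic-geometric
      mean form (q - 1) a ^ q + b ^ q - q a ^ (q - 1) b is a sum of squares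
      [sos_amgm]; it absorbs each mixed term, and what is left is a combination
      of the y_j ^ q with coefficients bounded below by a positive number once
      q (1 - rho) exceeds the number of forms
      [common_polynomial_of_polyhedral]. *)

Set Implicit Arguments.
Unset Strict Implicit.
Unset Printing Implicit Defensive.

Import Order.TTheory GRing.Theory Num.Theory numFieldNormedType.Exports.

Local Open Scope classical_set_scope.
Local Open Scope ring_scope.

(** * Sums of squares and Lie derivatives of polynomials *)

Section SumsOfSquares.
Variables (R : realType) (n : nat).
Implicit Types p q : mpoly.mpoly n R.

Lemma sos0 : sum_of_squares (0 : mpoly.mpoly n R).
Proof. by exists [::]; rewrite big_nil. Qed.

Lemma sosD p q : sum_of_squares p -> sum_of_squares q -> sum_of_squares (p + q).
Proof. by move=> [s ->] [t ->]; exists (s ++ t); rewrite big_cat. Qed.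

Lemma sos_sum (I : finType) (F : I -> mpoly.mpoly n R) :
  (forall i, sum_of_squares (F i)) -> sum_of_squares (\sum_i F i).
Proof.
move=> h; elim/big_ind: _ => //; [exact: sos0|exact: sosD].
Qed.

Lemma sos_sqrM p q : sum_of_squares q -> sum_of_squares (p ^+ 2 * q).
Proof.
move=> [s ->]; exists [seq p * f | f <- s].
by rewrite big_map mulr_sumr; apply: eq_bigr => f _; rewrite exprMn.
Qed.

Lemma sos_sqr p : sum_of_squares (p ^+ 2).
Proof. by exists [:: p]; rewrite big_seq1. Qed.

Lemma sosZ (c : R) p : 0 <= c -> sum_of_squares p -> sum_of_squares (c *: p).
Proof.
move=> c0 [s ->]; exists [seq Num.sqrt c *: f | f <- s].
rewrite big_map scaler_sumr; apply: eq_bigr => f _.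
by rewrite exprZn sqr_sqrtr.
Qed.

Lemma sos_eval_ge0 p x : sum_of_squares p -> 0 <= poly_eval p x.
Proof.
move=> [s ->]; rewrite /poly_eval raddf_sum /= sumr_ge0// => f _.
by rewrite rmorphXn /= sqr_ge0.
Qed.

Lemma amgm_doubling (K : comNzRingType) (q : nat) (a b : K) :
  a ^+ q.+1.*2 *+ q.+1.*2.-1 + b ^+ q.+1.*2 - a ^+ q.+1.*2.-1 * b *+ q.+1.*2 =
  (a ^+ q.+1 - b ^+ q.+1) ^+ 2 +
  a ^+ q.+1 * (a ^+ q.+1 *+ q + b ^+ q.+1 - a ^+ q * b *+ q.+1) *+ 2.
Proof.
have -> : a ^+ q.+1.*2 = (a * a ^+ q) ^+ 2 by rewrite -exprS -exprM muln2.
have -> : b ^+ q.+1.*2 = (b ^+ q.+1) ^+ 2 by rewrite -exprM muln2.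
rewrite (_ : a ^+ _.-1 = a * a ^+ q * a ^+ q); last first.
  by rewrite -!exprS -exprD addSn addnn.
rewrite (_ : q.+1.*2.-1 = q.*2.+1)// (exprS a q).
have -> : (q.+1.*2)%N = (2 + q * 2)%N by rewrite -muln2.
have -> : (q.*2.+1)%N = (1 + q * 2)%N by rewrite -muln2.
move: (a ^+ q) (b ^+ q.+1) => x y; ring.
Qed.

(** The defect S_q of the weighted arithmetic-geometric mean inequality. For
    powers of 2 it is a sum of squares by induction from (a - b) ^ 2, thanks to
    the doubling identity S_2q = (a ^ q - b ^ q) ^ 2 + 2 a ^ q S_q, in which
    a ^ q is a square. *)
Lemma sos_amgm (r : nat) (a b : mpoly.mpoly n R) : let q := (2 ^ r.+1)%N in
  sum_of_squares (a ^+ q *+ q.-1 + b ^+ q - a ^+ q.-1 * b *+ q).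
Proof.
elim: r => [|r IH] /=.
  rewrite (_ : _ - _ = (a - b) ^+ 2); first exact: sos_sqr.
  by rewrite expn1 /= sqrrB expr1 mulr1n addrAC.
have [q eq] : exists q : nat, (2 ^ r.+1 = q.+1)%N.
  by exists (2 ^ r.+1).-1; rewrite prednK// expn_gt0.
have [q2 eq2] : exists q2 : nat, (2 ^ r.+1 = q2 * 2)%N.
  by exists (2 ^ r)%N; rewrite expnS mulnC.
have -> : (2 ^ r.+2 = q.+1.*2)%N by rewrite -eq expnS mul2n.
move: IH; rewrite /= eq amgm_doubling => IH.
apply: sosD; first exact: sos_sqr.
rewrite -scaler_nat; apply: sosZ; rewrite ?ler0n//.
have sq : a ^+ q.+1 = (a ^+ q2) ^+ 2 by rewrite -exprM -eq2 eq.
by rewrite {1}sq; exact: sos_sqrM.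
Qed.

End SumsOfSquares.

Section LinearForms.
Variables (R : realType) (n : nat).
Implicit Types (p q : mpoly.mpoly n R) (c : 'rV[R]_n) (M : 'M[R]_n).

Definition linear_form c : mpoly.mpoly n R :=
  \sum_k c ord0 k *: mpoly.mpolyX R (mpoly.mnm1 k).

Lemma linear_form_is_linear : linear linear_form.
Proof.
move=> a c d; rewrite /linear_form scaler_sumr -big_split /=.
by apply: eq_bigr => k _; rewrite !mxE scalerDl scalerA.
Qed.

HB.instance Definition _ := @GRing.isLinear.Build R 'rV[R]_n
  (mpoly.mpoly n R) _ linear_form linear_form_is_linear.

Lemma poly_eval_linear_form c x :
  poly_eval (linear_form c) x = (c *m x) ord0 ord0.
Proof.
rewrite /poly_eval raddf_sum mxE; apply: eq_bigr => k _ /=.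
by rewrite mpoly.mevalZ mpoly.mevalXU.
Qed.

Lemma lie_derivative_is_linear M : linear (lie_derivative M).
Proof.
move=> a p q; rewrite /lie_derivative scaler_sumr -big_split /=.
by apply: eq_bigr => j _; rewrite linearP mulrDl scalerAl.
Qed.

HB.instance Definition _ M := @GRing.isLinear.Build R (mpoly.mpoly n R)
  (mpoly.mpoly n R) _ (lie_derivative M) (lie_derivative_is_linear M).

Lemma lie_derivativeM M p q :
  lie_derivative M (p * q) = lie_derivative M p * q + p * lie_derivative M q.
Proof.
rewrite /lie_derivative mulr_suml mulr_sumr -big_split /=.
by apply: eq_bigr => j _; rewrite mpoly.mderivM mulrDl mulrAC mulrA.
Qed.

Lemma lie_derivative1 M : lie_derivative M 1 = 0.
Proof.
by rewrite /lie_derivative big1// => j _; rewrite mpoly.mderivC mul0r.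
Qed.

Lemma lie_derivativeXn M p (k : nat) :
  lie_derivative M (p ^+ k) = p ^+ k.-1 * lie_derivative M p *+ k.
Proof.
elim: k => [|k IH]; first by rewrite expr0 lie_derivative1 mulr0n.
rewrite exprS lie_derivativeM IH; case: k {IH} => [|k] /=.
  by rewrite !expr0 !mulr1 mulr0n mulr0 addr0 mul1r.
by rewrite [in RHS]mulrS mulrnAr mulrA -exprS [X in X + _]mulrC.
Qed.

Lemma mderiv_variable (j k : 'I_n) :
  mpoly.mderiv j (mpoly.mpolyX R (mpoly.mnm1 k)) = (k == j)%:R.
Proof.
rewrite mpoly.mderivX mpoly.mnm1E; have [->|_] := eqVneq k j.
  have -> : mpoly.mnm_sub (mpoly.mnm1 j) (mpoly.mnm1 j) = mpoly.mnm0.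
    by apply/mpoly.mnmP => i; rewrite mpoly.mnmBE subnn mpoly.mnm0E.
  by rewrite mpoly.mpolyX0 scale1r.
by rewrite scale0r.
Qed.

Lemma lie_derivativeX M k :
  lie_derivative M (mpoly.mpolyX R (mpoly.mnm1 k)) = linear_field M k.
Proof.
rewrite /lie_derivative (bigD1 k)//= big1 ?addr0 => [|j jk].
  by rewrite mderiv_variable eqxx mul1r.
by rewrite mderiv_variable eq_sym (negbTE jk) mul0r.
Qed.

Lemma lie_derivative_linear_form M c :
  lie_derivative M (linear_form c) = linear_form (c *m M).
Proof.
rewrite /linear_form linear_sum /=.
under eq_bigr => k _ do rewrite linearZ /= lie_derivativeX /linear_field scaler_sumr.
rewrite exchange_big /=; apply: eq_bigr => k _.
rewrite mxE scaler_suml; apply: eq_bigr => j _; by rewrite scalerA.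
Qed.

Lemma linear_form_homog c : linear_form c \is mpoly.ishomog1 1 (@mpoly.mdeg n).
Proof.
rewrite /linear_form; apply: rpred_sum => k _.
by apply: mpoly.dhomogZ; rewrite mpoly.dhomogX /= mpoly.mdeg1.
Qed.

End LinearForms.

(** * Sums of powers of the linear forms of a contracted polyhedral norm *)

Definition has_common_sos_lyapunov (R : realType) (n m : nat)
    (A : 'I_m -> 'M[R]_n) :=
  exists W : mpoly.mpoly n R,
    [/\ homogeneous W, sum_of_squares W, positive_definite W &
      forall i : 'I_m,
        sum_of_squares (- lie_derivative (A i) W) /\
        positive_definite (- lie_derivative (A i) W)].

Section PolyhedralToPolynomial.
Variables (R : realType) (n m : nat) (A : 'I_m -> 'M[R]_n).
Variables (J : finType) (c : J -> 'rV[R]_n) (mu : 'I_m -> J -> J -> R).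
Variables (h rho : R) (e : 'I_n -> J).
Hypothesis h_gt0 : 0 < h.
Hypothesis rho_lt1 : rho < 1.
Hypothesis cA : forall i j,
  c j *m (1%:M + h *: A i) = \sum_k mu i j k *: c k.
Hypothesis mu_rows : forall i j, \sum_k `|mu i j k| <= rho.
Hypothesis c_coord : forall k (x : 'cV[R]_n), (c (e k) *m x) ord0 ord0 = x k ord0 :> R.

Let y j := linear_form (c j).

Definition power_sum (r : nat) : mpoly.mpoly n R := \sum_j y j ^+ (2 ^ r.+1).

Let W_eval r x :
  poly_eval (power_sum r) x = \sum_j (c j *m x) ord0 ord0 ^+ (2 ^ r.+1).
Proof.
rewrite /poly_eval raddf_sum; apply: eq_bigr => j _ /=.
by rewrite rmorphXn /= -poly_eval_linear_form.
Qed.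

Let W_sos r : sum_of_squares (power_sum r).
Proof. by apply: sos_sum => j; rewrite expnSr exprM; exact: sos_sqr. Qed.

Let W_pd r : positive_definite (power_sum r).
Proof.
move=> x x0; rewrite W_eval.
have ev (j : J) : 0 <= (c j *m x) ord0 ord0 ^+ (2 ^ r.+1) :> R.
  by rewrite expnSr exprM sqr_ge0.
have [k xk] : exists k, x k ord0 != 0.
  apply/not_existsP => xk; case/eqP: x0; apply/colP => k; rewrite mxE.
  by apply/eqP/negbNE/negP/xk.
rewrite (bigD1 (e k))//= ltr_pwDl ?sumr_ge0//.
by rewrite lt_def ev c_coord expf_neq0.
Qed.

Let W_homogeneous r : homogeneous (power_sum r).
Proof.
have [W0|W0] := eqVneq (power_sum r) 0.
  by move=> l x; rewrite W0 /poly_eval !raddf0 mulr0.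
have Wh : power_sum r \is mpoly.ishomog1 (2 ^ r.+1) (@mpoly.mdeg n).
  apply: rpred_sum => j _.
  by have := mpoly.dhomogMn (2 ^ r.+1) (linear_form_homog (c j)); rewrite mul1n.
have Wd : poly_degree (power_sum r) = (2 ^ r.+1)%N.
  by apply: (mpoly.dhomog_uniq W0 _ Wh); exact: mpoly.dhomog_msize Wh.
move=> l x; rewrite Wd !W_eval mulr_sumr; apply: eq_bigr => j _.
by rewrite -scalemxAr mxE exprMn.
Qed.

(** The mixed terms mu_ijk y_j ^ (q - 1) y_k are completed to
    arithmetic-geometric mean forms. Putting the sign of mu_ijk on y_k leaves
    y_k ^ q unchanged, q being even, so only absolute values remain in the
    coefficients of the pure powers. *)
Lemma lie_derivative_power_sum (r : nat) i : let q := (2 ^ r.+1)%N in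
  - (h *: lie_derivative (A i) (power_sum r)) =
  \sum_j \sum_k `|mu i j k| *:
     (y j ^+ q *+ q.-1 + (Num.sg (mu i j k) *: y k) ^+ q
        - y j ^+ q.-1 * (Num.sg (mu i j k) *: y k) *+ q) +
  \sum_j (q%:R - q.-1%:R * \sum_k `|mu i j k| - \sum_k `|mu i k j|) *: y j ^+ q.
Proof.
move=> q.
have hA j : h *: lie_derivative (A i) (y j) = \sum_k mu i j k *: y k - y j.
  rewrite /y lie_derivative_linear_form -linearZ /= scalemxAr.
  have -> : c j *m (h *: A i) = \sum_k mu i j k *: c k - c j.
    by rewrite -cA mulmxDr mulmx1 addrAC subrr add0r.
  by rewrite linearB linear_sum /=; congr (_ - _); apply: eq_bigr => k _; rewrite linearZ.
have hL : h *: lie_derivative (A i) (power_sum r) =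
    \sum_j (y j ^+ q.-1 * (\sum_k mu i j k *: y k - y j)) *+ q.
  rewrite [lie_derivative _ _]linear_sum scaler_sumr; apply: eq_bigr => j _.
  by rewrite /= lie_derivativeXn -hA -scalerAr scalerMnr.
have q_gt0 : (0 < q)%N by rewrite expn_gt0.
have sgq j k : `|mu i j k| *: (Num.sg (mu i j k) *: y k) ^+ q = `|mu i j k| *: y k ^+ q.
  rewrite exprZn scalerA; congr (_ *: _).
  have [->|mu0] := eqVneq (mu i j k) 0; first by rewrite normr0 mul0r.
  by rewrite /q expnS exprM sqr_sg mu0 expr1n mulr1.
rewrite hL -sumrN.
under [X in _ = _ + X]eq_bigr => j _ do rewrite !scalerBl.
rewrite !sumrB.
have -> : \sum_j \sum_k `|mu i j k| *: (y j ^+ q *+ q.-1 + (Num.sg (mu i j k) *: y k) ^+ q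
        - y j ^+ q.-1 * (Num.sg (mu i j k) *: y k) *+ q) =
   \sum_j (q.-1%:R * \sum_k `|mu i j k|) *: y j ^+ q +
   \sum_j (\sum_k `|mu i k j|) *: y j ^+ q
   - \sum_j (y j ^+ q.-1 * \sum_k mu i j k *: y k) *+ q.
  under [X in _ = _ + X - _]eq_bigr => j _ do rewrite scaler_suml.
  rewrite [X in _ = _ + X - _]exchange_big -big_split -sumrB /=.
  apply: eq_bigr => j _.
  rewrite mulr_sumr scaler_suml mulr_sumr -sumrMnl -big_split -sumrB /=.
  apply: eq_bigr => k _.
  rewrite scalerBr scalerDr sgq; congr (_ + _ - _).
    by rewrite -scaler_nat scalerA mulrC.
  by rewrite -scalerMnr -!scalerAr scalerA [`|_| * _]mulrC -numEsg.

under eq_bigr => j _ do rewrite mulrBr mulrnBl -exprSr prednK// opprB -scaler_nat.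
rewrite sumrB; set a := \sum_j _; set b := \sum_j _; set d := \sum_j _.
set f := \sum_j _; clear; ring.
Qed.

(** In the coefficient of y_j ^ q, the row sum of |mu| is weighted by q - 1
    and is at most rho, whereas the column sum, over which there is no control
    except that it is at most the number of forms, has weight 1. Hence a large
    q makes all these coefficients positive. *)
Lemma common_polynomial_of_polyhedral : has_common_sos_lyapunov A.
Proof.
(* r < 2 ^ (r + 1) = q, so this choice ensures #|J| < q (1 - rho). *)
pose r := Num.bound (#|J|%:R / (1 - rho)).
have rho1 : 0 < 1 - rho by rewrite subr_gt0.
have r_large : #|J|%:R < (2 ^ r.+1)%:R * (1 - rho) :> R.
  rewrite -ltr_pdivrMr//; apply: (lt_le_trans (archi_boundP _)).
    by rewrite divr_ge0// ltW.
  by rewrite ler_nat; apply: leq_trans (ltnW (ltn_expl r (ltnSn 1))) _; rewrite leq_exp2l.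
exists (power_sum r); split; [exact: W_homogeneous|exact: W_sos|exact: W_pd|].
move=> i; set q := (2 ^ r.+1)%N.
have q_gt0 : (0 < q)%N by rewrite expn_gt0.
pose d : R := q%:R * (1 - rho) - #|J|%:R.
have d_gt0 : 0 < d by rewrite subr_gt0.
have mu_le1 j k : `|mu i j k| <= 1.
  rewrite (le_trans _ (ltW rho_lt1))// (le_trans _ (mu_rows i j))//.
  by rewrite (bigD1 k)//= lerDl sumr_ge0.
have coef j : 0 <= q%:R - q.-1%:R * \sum_k `|mu i j k| - \sum_k `|mu i k j| - d.
  have c1 : \sum_k `|mu i k j| <= #|J|%:R.
    by rewrite -sum1_card natr_sum; apply: ler_sum.
  have c2 : q.-1%:R * \sum_k `|mu i j k| <= q%:R * rho.
    apply: ler_pM; rewrite ?ler_nat ?leq_pred ?sumr_ge0//.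
  by rewrite /d; lra.
have [S [Ssos LS]] : exists S, sum_of_squares S /\
    - lie_derivative (A i) (power_sum r) = h^-1 *: (S + d *: power_sum r).
  exists (\sum_j \sum_k `|mu i j k| *:
     (y j ^+ q *+ q.-1 + (Num.sg (mu i j k) *: y k) ^+ q
        - y j ^+ q.-1 * (Num.sg (mu i j k) *: y k) *+ q) +
    \sum_j (q%:R - q.-1%:R * \sum_k `|mu i j k| - \sum_k `|mu i k j| - d) *: y j ^+ q).
  split.
    apply: sosD; apply: sos_sum => j.
      by apply: sos_sum => k; apply: sosZ => //; exact: sos_amgm.
    by apply: sosZ => //; rewrite /q expnSr exprM; exact: sos_sqr.
  apply: (can_inj (scalerK (lt0r_neq0 h_gt0))).
  rewrite scalerN lie_derivative_power_sum -/q scalerA mulfV ?lt0r_neq0// scale1r.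
  rewrite -addrA; congr (_ + _); rewrite /power_sum scaler_sumr -big_split /=.
  by apply: eq_bigr => j _; rewrite -scalerDl subrK.
have hV : 0 < h^-1 by rewrite invr_gt0.
rewrite LS; split.
  by apply: sosZ; rewrite ?ltW//; apply: sosD => //; apply: sosZ; rewrite ?ltW.
move=> x x0; rewrite /poly_eval mpoly.mevalZ mpoly.mevalD mpoly.mevalZ.
rewrite mulr_gt0// ltr_wpDl//; first exact: sos_eval_ge0.
by rewrite mulr_gt0//; exact: W_pd.
Qed.

End PolyhedralToPolynomial.

(** * Polyhedral norms from contractive products *)

Section WordProduct.
Variables (R : realType) (n : nat) (T : Type) (B : T -> 'M[R]_n).

(** The first letter of the word acts first. *)
Fixpoint word_product (w : seq T) : 'M[R]_n :=
  if w is i :: w' then word_product w' *m B i else 1%:M.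

Lemma word_product_cat w1 w2 :
  word_product (w1 ++ w2) = word_product w2 *m word_product w1.
Proof. by elim: w1 => [|i w1 IH] /=; rewrite ?mulmx1// IH mulmxA. Qed.

End WordProduct.

Lemma bernoulli_le (R : realDomainType) (x : R) (k : nat) :
  0 <= x <= 1 -> 1 - x *+ k <= (1 - x) ^+ k.
Proof.
move=> /andP[x0 x1]; elim: k => [|k IH]; first by rewrite mulr0n subr0 expr0.
have h1 : (1 - x) * (1 - x *+ k) <= (1 - x) * (1 - x) ^+ k.
  by apply: ler_wpM2l => //; rewrite subr_ge0.
rewrite exprS (le_trans _ h1)// mulrSr -mulr_natr.
have : 0 <= x * (x * k%:R) by rewrite !mulr_ge0.
move: (k%:R) => K hx; lra.
Qed.

Section ContractiveToPolyhedral.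
Variables (R : realType) (n m : nat) (A : 'I_m -> 'M[R]_n).

Variables (h : R) (L : nat).
Hypothesis h_gt0 : 0 < h.
Let B i := 1%:M + h *: A i.
Hypothesis contractive : forall w, size w = L.+1 ->
  forall j, \sum_k `|word_product B w j k| <= 2^-1.

(** The forms are indexed by pairs (w, j), standing for rho ^ (- size w) times
    row j of the product along the word w, with size w <= L. Multiplying by B_i
    on the right prepends i to w. As long as the length stays at most L, the
    result is rho times another form of the family; at length L + 1 it is a
    combination of the coordinates, whose coefficients have a small sum by
    hypothesis. *)
Lemma common_polynomial_of_contractive : has_common_sos_lyapunov A.
Proof.
(* With this x, Bernoulli's inequality gives 1 / 2 <= rho ^ (L + 1). *)
pose x : R := (2 * L.+1%:R)^-1.
have L0 : 0 < L.+1%:R :> R by rewrite ltr0n.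
have xL : x * L.+1%:R = 2^-1 by rewrite /x invfM mulfVK// lt0r_neq0.
have x_gt0 : 0 < x by rewrite invr_gt0 mulr_gt0.
have x_le : x <= 2^-1 by rewrite -xL ler_pMr// ler1n.
pose rho := 1 - x.
have rho_gt0 : 0 < rho by rewrite /rho; lra.
have rho_lt1 : rho < 1 by rewrite /rho; lra.
have rhoL : 2^-1 <= rho ^+ L.+1.
  apply: le_trans (bernoulli_le _ _); last by apply/andP; split; lra.
  by rewrite -[x *+ _]mulr_natr xL; lra.
pose J : finType := ({bseq L of 'I_m} * 'I_n)%type.
pose c (p : J) : 'rV[R]_n := rho ^- size p.1 *: row p.2 (word_product B p.1).
pose mu i (p p' : J) : R :=
  if (size p.1 < L)%N then
    if ((p'.1 : seq 'I_m) == i :: p.1) && (p'.2 == p.2) then rho else 0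
  else if p'.1 == [bseq] then rho ^- L * word_product B (i :: p.1) p.2 p'.2 else 0.
apply: (@common_polynomial_of_polyhedral R n m A J c mu h rho
  (fun k => ([bseq], k)) h_gt0 rho_lt1).
- move=> i [w j]; rewrite -/(B i) /c /mu /=.
  case: ltnP => wL.
    pose w1 : {bseq L of 'I_m} := Bseq (wL : (size (i :: w) <= L)%N).
    rewrite (bigD1 (w1, j))//= !eqxx /= big1 ?addr0; last first.
      move=> [w' j']; rewrite xpair_eqE -val_eqE /= => /negbTE ->.
      by rewrite scale0r.
    rewrite scalerA exprS invfM mulrA mulfV ?lt0r_neq0// mul1r.
    by rewrite -scalemxAl -row_mul.
  have wE : size w = L by apply/eqP; rewrite eqn_leq wL size_bseq.
  pose F w' k := (if w' == [bseq] :> {bseq L of 'I_m}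
    then rho ^- L * word_product B (i :: w) j k else 0) *:
    (rho ^- size w' *: row k (word_product B w')).
  rewrite -(pair_bigA _ F) /= (bigD1 [bseq])//= [X in _ + X]big1 ?addr0; last first.
    by move=> w' /negbTE w'0; rewrite big1// => k _; rewrite /F w'0 scale0r.
  rewrite wE -scalemxAl -row_mul [in LHS](row_sum_delta (row j _)) scaler_sumr.
  apply: eq_bigr => k _; rewrite /F eqxx /= expr0 invr1 scale1r !scalerA.
  by rewrite !mxE row1.
- move=> i [w j]; rewrite /mu /=.
  case: ltnP => wL.
    pose w1 : {bseq L of 'I_m} := Bseq (wL : (size (i :: w) <= L)%N).
    rewrite (bigD1 (w1, j))//= !eqxx /= big1 ?addr0 ?gtr0_norm//.
    move=> [w' j']; rewrite xpair_eqE -val_eqE /= => /negbTE ->.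
    by rewrite normr0.
  have wE : size w = L by apply/eqP; rewrite eqn_leq wL size_bseq.
  pose F w' k := `|if w' == [bseq] :> {bseq L of 'I_m}
    then rho ^- L * word_product B (i :: w) j k else 0|.
  rewrite -(pair_bigA _ F) /= (bigD1 [bseq])//= [X in _ + X]big1 ?addr0; last first.
    by move=> w' /negbTE w'0; rewrite big1// => k _; rewrite /F w'0 normr0.
  under eq_bigr => k _ do rewrite /F eqxx normrM ger0_norm ?invr_ge0 ?exprn_ge0 ?ltW//.
  rewrite -mulr_sumr ler_pdivrMl ?exprn_gt0// -exprSr.
  by apply: le_trans rhoL; apply: contractive; rewrite /= wE.
- move=> k y; rewrite /c /= expr0 invr1 scale1r row1.
  by rewrite -rowE mxE.
Qed.

End ContractiveToPolyhedral.

(** * Norms and compactness for matrices *)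

Section MatrixNorm.
Variable R : realType.

Lemma ler_entry_norm (p q : nat) (M : 'M[R]_(p, q)) i j : `|M i j| <= `|M|.
Proof.
rewrite [leRHS]/Num.norm /= mx_normrE.
by apply/bigmax_geP; right => /=; exists (i, j).
Qed.

Lemma ler_norm_entry (p q : nat) (M : 'M[R]_(p, q)) (a : R) :
  0 <= a -> (forall i j, `|M i j| <= a) -> `|M| <= a.
Proof.
move=> a0 Ma; rewrite [leLHS]/Num.norm /= mx_normrE.
by apply/bigmax_leP; split => // -[i j] _ /=.
Qed.

Lemma norm_mulmx (n p : nat) (M : 'M[R]_n) (x : 'M[R]_(n, p)) :
  `|M *m x| <= n%:R * `|M| * `|x|.
Proof.
apply: ler_norm_entry; first by rewrite !mulr_ge0.
move=> i j; rewrite mxE (le_trans (ler_norm_sum _ _ _))//.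
have -> : n%:R * `|M| * `|x| = \sum_(k < n) `|M| * `|x|.
  by rewrite sumr_const card_ord -mulrA mulr_natl.
by apply: ler_sum => k _; rewrite normrM ler_pM ?ler_entry_norm.
Qed.

Lemma norm_trmx (p q : nat) (M : 'M[R]_(p, q)) : `|M^T| = `|M|.
Proof.
apply/eqP; rewrite eq_le; apply/andP; split; apply: ler_norm_entry => // i j.
  by rewrite mxE; exact: ler_entry_norm.
by have := ler_entry_norm M^T j i; rewrite mxE.
Qed.

Lemma trmx_continuous (p q : nat) : continuous (@trmx R p q).
Proof.
move=> M; apply/(@cvgrPdist_lt _ _ _ _ (nbhs_filter M)) => e e0.
apply/nbhs_ballP; exists e => //= N; rewrite -ball_normE /= => MN.
by rewrite -raddfB norm_trmx.
Qed.

Lemma cV_bounded_closed_compact (n : nat) (S : set 'cV[R]_n) :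
  bounded_set S -> closed S -> compact S.
Proof.
move=> [K [Kreal SK]] Sc.
have -> : S = trmx @` (trmx @^-1` S : set 'rV[R]_n).
  rewrite image_preimage// -subTset => x _; exists x^T => //; exact: trmxK.
apply: continuous_compact.
  by apply: continuous_subspaceT; exact: trmx_continuous.
apply: bounded_closed_compact.
  by exists K; split => // y Ky v /= Sv; rewrite -norm_trmx; exact: SK.
by apply: closed_comp => // v _; exact: trmx_continuous.
Qed.

Lemma bounded_sequence_cluster (n : nat) (u : nat -> 'cV[R]_n) (K : R) :
  (forall k, `|u k| <= K) ->
  exists y, forall (e : R) (N : nat), 0 < e ->
    exists2 k, (N <= k)%N & `|u k - y| < e.
Proof.
move=> uK.
have cK : compact [set x : 'cV[R]_n | `|x| <= K].
  apply: cV_bounded_closed_compact.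
    exists K; split; first exact: num_real.
    by move=> y Ky v /= vK; exact: le_trans vK (ltW Ky).
  apply: (@closed_comp _ _ (fun x : 'cV[R]_n => `|x|) [set x | x <= K]).
    by move=> x _; exact: norm_continuous.
  exact: closed_le.
have [|y [_ cy]] := cK (u @ \oo) _.
  by apply: filterS (@filterT _ \oo _) => k _ /=; exact: uK.
exists y => e N e0.
have [||_ [[k Nk <-] ky]] := cy [set u k | k in [set k | (N <= k)%N]] (ball y e).
- by exists N => // k /= Nk; exists k.
- exact: nbhsx_ballx.
by exists k => //; rewrite -normrN opprB; move: ky; rewrite -ball_normE.
Qed.

End MatrixNorm.

(** * Uniform decay of products of matrices *)

Section UniformDecay.
Variables (R : realType) (n : nat) (S : set 'M[R]_n).

Fixpoint products (k : nat) : set 'M[R]_n :=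
  if k is k'.+1 then [set M | exists g s, [/\ products k' g, S s & M = g *m s]]
  else [set 1%:M].

Variable K : R.
Hypothesis K_gt0 : 0 < K.
Hypothesis products_bounded : forall k g (x : 'cV[R]_n),
  products k g -> `|g *m x| <= K * `|x|.
Hypothesis orbits_decay : forall (s : nat -> 'M[R]_n) (x : nat -> 'cV[R]_n),
  (forall k, S (s k)) -> (forall k, x k.+1 = s k *m x k) ->
  forall e : R, 0 < e -> exists k, `|x k| < e.

(** Quantitative failure of decay: a substitute, free of suprema, for a lower
    bound a on the superior limit over k of the largest norm of g x, with g a
    product of k elements. *)
Definition persists (a : R) (x : 'cV[R]_n) := forall k, exists l g,
  [/\ (k <= l)%N, products l g & a < `|g *m x|].

Lemma products1 s : S s -> products 1 s.
Proof. by move=> Ss; exists 1%:M, s; split; rewrite ?mul1mx. Qed.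

(** For every k some s_k in S starts a product of length more than k that takes
    x to a vector of norm more than a. The vectors s_k x are bounded, hence
    cluster at some y, and a single s_k0 with s_k0 x close to y does for all
    lengths: as the products are uniformly Lipschitz, those that take some
    s_k x, close to y, above a take s_k0 x above b. *)
Lemma persists_step (a b : R) x : b < a -> persists a x ->
  exists2 s, S s & persists b (s *m x).
Proof.
move=> ba Px.
have /choice [f fP] (k : nat) : exists p : 'M[R]_n * 'M[R]_n, exists l,
    [/\ (k <= l)%N, products l p.1, S p.2 & a < `|p.1 *m (p.2 *m x)|].
  have [l [g [kl Pg ag]]] := Px k.+1.
  case: l kl Pg => // l kl [g' [s [Pg' Ss gE]]].
  by exists (g', s), l; split => //=; rewrite mulmxA -gE.
have [y yP] : exists y, forall (e : R) (N : nat), 0 < e ->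
    exists2 k, (N <= k)%N & `|(f k).2 *m x - y| < e.
  apply: (@bounded_sequence_cluster _ _ _ (K * `|x|)) => k.
  by have [l [_ _ Ss _]] := fP k; apply: products_bounded (products1 Ss).
pose eta := (a - b) / (2 * K).
have eta0 : 0 < eta by rewrite divr_gt0 ?mulr_gt0// subr_gt0.
have [k0 _ k0y] := yP eta 0%N eta0.
have [_ [_ _ Ss _]] := fP k0.
exists (f k0).2 => // k.
have [k1 kk1 k1y] := yP eta k eta0.
have [l [k1l Pg _ ag]] := fP k1.
exists l, (f k1).1; split => //; first exact: leq_trans k1l.
set x0 := (f k0).2 *m x in k0y *; set x1 := (f k1).2 *m x in ag k1y *.
set g := (f k1).1 in Pg ag *.
have x10 : `|x1 - x0| < 2 * eta.
  rewrite (_ : x1 - x0 = (x1 - y) - (x0 - y)); last by rewrite opprB addrA subrK.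
  by rewrite (le_lt_trans (ler_normB _ _))// mulr_natl mulr2n ltrD.
have g10 : `|g *m x1| - `|g *m x0| <= K * (2 * eta).
  rewrite (le_trans (lerB_dist _ _))// -mulmxBr (le_trans (products_bounded _ Pg))//.
  by rewrite ler_pM2l// ltW.
have Keta : K * (2 * eta) = a - b by rewrite /eta; field; rewrite lt0r_neq0.
rewrite Keta in g10; lra.
Qed.

(** Iterating the previous step with levels decreasing from a to a / 2 gives
    an orbit that stays away from 0. *)
Lemma not_persists (a : R) x : 0 < a -> ~ persists a x.
Proof.
move=> a0 Px.
pose b (k : nat) : R := a / 2 + a / 2 / 2 ^+ k.
have bS k : b k.+1 < b k.
  rewrite ltrD2l ltr_pM2l ?divr_gt0// ltf_pV2 ?posrE ?exprn_gt0//.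
  by rewrite exprS ltr_pMl ?exprn_gt0// ltr1n.
have b_gt k : a / 2 < b k by rewrite ltrDl !divr_gt0.
have /choice [f fP] (p : nat * 'cV[R]_n) : exists s,
    persists (b p.1) p.2 -> S s /\ persists (b p.1.+1) (s *m p.2).
  have [Pp|nPp] := pselect (persists (b p.1) p.2); last by exists 0.
  by have [s Ss Ps] := persists_step (bS _) Pp; exists s.
pose z := fix z k := if k is k'.+1 then f (k', z k') *m z k' else x.
have Pz k : persists (b k) (z k).
  elim: k => [|k IH] /=; last exact: (fP (k, z k) IH).2.
  by rewrite /b expr0 divr1 -splitr.
have [k] : exists k, `|z k| < a / 2 / K.
  apply: (@orbits_decay (fun k => f (k, z k)) z) => //.
    by move=> k; exact: (fP (k, z k) (Pz k)).1.
  by rewrite !divr_gt0.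
have [l [g [_ Pg bg]]] := Pz k 0%N.
rewrite ltr_pdivlMr// mulrC => zk.
have := products_bounded (z k) Pg; have := b_gt k; lra.
Qed.

(** A product is controlled by its values on the finitely many vectors of the
    canonical basis, none of which persists: this is how pointwise decay
    becomes uniform. *)
Lemma uniform_decay (e : R) : 0 < e -> exists k0, forall k g (x : 'cV[R]_n),
  (k0 <= k)%N -> products k g -> `|g *m x| <= e * `|x|.
Proof.
move=> e0; pose a := e / (n%:R + 1).
have n1 : 0 < n%:R + 1 :> R by rewrite ltr_wpDl.
have a0 : 0 < a by rewrite divr_gt0.
have /choice [f fP] (j : 'I_n) : exists k0 : nat, forall (k : nat) (g : 'M[R]_n),
    (k0 <= k)%N -> products k g -> `|g *m (delta_mx j ord0 : 'cV[R]_n)| <= a.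
  have := @not_persists a (delta_mx j ord0) a0.
  move=> /existsNP[k0 nP]; exists k0 => k g k0k Pg; rewrite leNgt.
  by apply/negP => ag; apply: nP; exists k, g.
exists (\max_j f j) => k g x fk Pg.
have xE : x = \sum_j x j ord0 *: delta_mx j ord0.
  by rewrite [LHS]matrix_sum_delta; apply: eq_bigr => j _; rewrite big_ord1.
rewrite {1}xE mulmx_sumr (le_trans (ler_norm_sum _ _ _))//.
apply: (@le_trans _ _ (\sum_(j < n) a * `|x|)).
  apply: ler_sum => j _; rewrite -scalemxAr normrZ mulrC.
  by rewrite ler_pM ?ler_entry_norm//; apply: fP Pg; exact: leq_trans (leq_bigmax _) fk.
rewrite sumr_const card_ord -[leLHS]mulr_natl mulrA ler_wpM2r//.
by rewrite /a mulrCA ger_pMr// ler_pdivrMr// mul1r lerDl.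
Qed.

End UniformDecay.

(** * Euler discretization *)

Section EulerDiscretization.
Variables (R : realType) (n m : nat) (A : 'I_m -> 'M[R]_n).
Variables (F : 'I_m * nat -> 'M[R]_n) (K : R).
Hypothesis K_gt0 : 0 < K.

(** A letter (i, N) means that A_i is active during a time 1 / (N + 1). *)
Definition duration (w : seq ('I_m * nat)) : R := \sum_(p <- w) p.2.+1%:R^-1.

Hypothesis F_first_order : forall e : R, 0 < e ->
  exists N0 : nat, forall i N, (N0 <= N)%N ->
    `|F (i, N) - (1%:M + N.+1%:R^-1 *: A i)| <= e / N.+1%:R.
Hypothesis F_bounded : forall w (x : 'cV[R]_n), `|word_product F w *m x| <= K * `|x|.
Hypothesis F_decay : forall (w : nat -> seq ('I_m * nat)) (x : nat -> 'cV[R]_n),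
  (forall k, duration (w k) = 1) ->
  (forall k, x k.+1 = word_product F (w k) *m x k) ->
  forall e : R, 0 < e -> exists k, `|x k| < e.

Definition unit_time_maps : set 'M[R]_n :=
  [set M | exists2 w, duration w = 1 & M = word_product F w].

Lemma products_words k g : products unit_time_maps k g ->
  exists w, g = word_product F w.
Proof.
elim: k g => [|k IH] g /=; first by move=> ->; exists [::].
move=> [g' [s [/IH[w ->] [v _ ->] ->]]]; exists (v ++ w).
by rewrite word_product_cat.
Qed.

Lemma words_products (N k : nat) (w : seq 'I_m) : size w = (k * N.+1)%N ->
  products unit_time_maps k (word_product F [seq (i, N) | i <- w]).
Proof.
elim: k w => [|k IH] w; first by rewrite mul0n => /size0nil ->.
move=> sw; rewrite -(cat_take_drop N.+1 w) map_cat word_product_cat.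
have Nw : (N.+1 <= size w)%N by rewrite sw mulSn leq_addr.
exists (word_product F [seq (i, N) | i <- drop N.+1 w]),
  (word_product F [seq (i, N) | i <- take N.+1 w]); split => //.
  by apply: IH; rewrite size_drop sw mulSn addKn.
exists [seq (i, N) | i <- take N.+1 w] => //.
rewrite /duration big_map /= big_const_seq count_predT size_takel//.
by rewrite iter_addr addr0 -[LHS]mulr_natr mulVf// pnatr_eq0.
Qed.

(** Replace the factors one by one, starting with the one that acts first:
    the exponential factors that follow are bounded by K, and each Euler factor
    that precedes has norm at most 1 + h a. *)
Lemma euler_error (a e : R) (N : nat) (w : seq 'I_m) (x : 'cV[R]_n) :
  let h := N.+1%:R^-1 in
  0 <= e -> 0 <= a ->
  (forall i (y : 'cV[R]_n), `|A i *m y| <= a * `|y|) ->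
  (forall i (y : 'cV[R]_n), `|(F (i, N) - (1%:M + h *: A i)) *m y| <= e * h * `|y|) ->
  `|word_product F [seq (i, N) | i <- w] *m x
      - word_product (fun i => 1%:M + h *: A i) w *m x|
  <= K * e * h * (size w)%:R * (1 + h * a) ^+ size w * `|x|.
Proof.
move=> h e0 a0 Aa Fe; have h0 : 0 < h by rewrite invr_gt0 ltr0n.
elim: w x => [|i w IH] x; first by rewrite /= subrr normr0 mulr0 !mul0r.
rewrite /= -!mulmxA.
set G := word_product F _; set H := word_product _ w.
set f := F (i, N); set b := 1%:M + _.
have -> : G *m (f *m x) - H *m (b *m x) =
  G *m ((f - b) *m x) + (G *m (b *m x) - H *m (b *m x)).
  by rewrite mulmxBl mulmxBr addrA subrK.
have bx : `|b *m x| <= (1 + h * a) * `|x|.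
  rewrite mulmxDl mul1mx (le_trans (ler_normD _ _))// mulrDl mul1r lerD2l.
  by rewrite -scalemxAl normrZ gtr0_norm// -mulrA ler_pM2l.
rewrite (le_trans (ler_normD _ _))//.
have h1 : `|G *m ((f - b) *m x)| <= K * e * h * (1 + h * a) ^+ (size w).+1 * `|x|.
  rewrite (le_trans (F_bounded _ _))//.
  apply: (@le_trans _ _ (K * (e * h * `|x|))).
    by rewrite ler_pM2l//; exact: Fe.
  have X1 : 1 <= (1 + h * a) ^+ (size w).+1.
    by rewrite exprn_ege1// lerDl mulr_ge0// ltW.
  rewrite !mulrA ler_wpM2r// ler_peMr//.
  by rewrite !mulr_ge0// ltW.
have h2 : `|G *m (b *m x) - H *m (b *m x)| <=
    K * e * h * (size w)%:R * (1 + h * a) ^+ (size w).+1 * `|x|.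
  rewrite (le_trans (IH _))// exprSr -!mulrA.
  have X0 : 0 <= (1 + h * a) ^+ size w by rewrite exprn_ge0// addr_ge0// mulr_ge0// ltW.
  by rewrite !ler_wpM2l// ltW.
rewrite (le_trans (lerD h1 h2))// -natr1.
set X := _ ^+ _; set Y := (size w)%:R; set Z := `|x|.
by rewrite le_eqVlt; apply/orP; left; apply/eqP; ring.
Qed.

(** Decay is first made uniform over k units of time, for products of
    exponentials with arbitrary steps; only then is the step 1 / (N + 1) chosen,
    so small that the error of the Euler products of length k (N + 1), which
    cover the same time, is negligible. *)
Lemma contractive_euler : exists h, exists L, 0 < h /\
  forall w, size w = L.+1 -> forall j,
    \sum_k `|word_product (fun i => 1%:M + h *: A i) w j k| <= 2^-1 :> R.
Proof.
have n1 : 0 < n%:R + 1 :> R by rewrite ltr_wpDl.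
pose e : R := (4 * (n%:R + 1))^-1.
have e0 : 0 < e by rewrite invr_gt0 mulr_gt0.
have [k0 decay] : exists k0, forall k g (x : 'cV[R]_n),
  (k0 <= k)%N -> products unit_time_maps k g -> `|g *m x| <= e * `|x|.
  apply: (@uniform_decay _ _ _ K) => //.
    by move=> k g x /products_words[w ->]; exact: F_bounded.
  move=> s x Ss xs.
  have /choice[w wP] k : exists w, duration w = 1 /\ s k = word_product F w.
    by have [w] := Ss k; exists w.
  by apply: (F_decay (w := w)) => k; [have [] := wP k|rewrite xs; have [_ ->] := wP k].
pose a : R := \sum_i n%:R * `|A i|.
have a0 : 0 <= a by apply: sumr_ge0 => i _; rewrite mulr_ge0.
have Aa i (y : 'cV[R]_n) : `|A i *m y| <= a * `|y|.
  rewrite (le_trans (norm_mulmx _ _))// ler_wpM2r// /a (bigD1 i)//= lerDl.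
  by apply: sumr_ge0 => j _; rewrite mulr_ge0.
(* The successor makes the length k (N + 1) of the words positive. *)
pose k := k0.+1.
pose C := K * k%:R * expR (a * k%:R) * (n%:R + 1).
have C0 : 0 < C by rewrite !mulr_gt0 ?expR_gt0 ?ltr0n.
have [N FN] := F_first_order (divr_gt0 e0 C0).
have eC : 0 <= e / C by rewrite ltW// divr_gt0.
pose h : R := N.+1%:R^-1; have h0 : 0 < h by rewrite invr_gt0 ltr0n.
exists h, (k * N.+1).-1; split => // w; rewrite prednK ?muln_gt0// => sw.
have small (x : 'cV[R]_n) :
    `|word_product (fun i => 1%:M + h *: A i) w *m x| <= 2 * e * `|x|.
  have d1 := decay k _ x (leqnSn _) (words_products sw).
  have d2 : `|word_product F [seq (i, N) | i <- w] *m x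
      - word_product (fun i => 1%:M + h *: A i) w *m x| <= e * `|x|.
    apply: le_trans (@euler_error a (n%:R * (e / C)) N w x _ a0 Aa _) _.
    - by rewrite mulr_ge0.
    - move=> i y; rewrite (le_trans (norm_mulmx _ _))// ler_wpM2r//.
      by rewrite -mulrA ler_wpM2l//; exact: FN.
    rewrite -/h ler_wpM2r//.
    have hw : h * (size w)%:R = k%:R by rewrite sw natrM mulrC mulfK ?pnatr_eq0.
    have ew : (1 + h * a) ^+ size w <= expR (a * k%:R).
      rewrite -hw mulrA [X in expR X]mulrC expRM_natl.
      have ha0 : 0 <= 1 + h * a by rewrite addr_ge0// mulr_ge0// ltW.
      by rewrite lerXn2r ?nnegrE ?expR_ge0// [a * h]mulrC expR_ge1Dx.
    rewrite -2!mulrA [h * _]mulrA hw.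
    apply: (@le_trans _ _ (K * (n%:R * (e / C)) * (k%:R * expR (a * k%:R)))).
      rewrite ler_wpM2l//; first by apply: mulr_ge0; [exact: ltW|exact: mulr_ge0].
      by rewrite ler_wpM2l.
    rewrite (_ : _ * _ = e * (n%:R / (n%:R + 1))); last first.
      rewrite /C; field.
      by rewrite lt0r_neq0//= (lt0r_neq0 (expR_gt0 _)) pnatr_eq0 lt0r_neq0.
    by rewrite ger_pMr// ler_pdivrMr// mul1r lerDl.
  rewrite -[X in `|X|](subrK (word_product F [seq (i, N) | i <- w] *m x)).
  rewrite (le_trans (ler_normD _ _))// -opprB normrN mulr_natl mulr2n mulrDl.
  exact: lerD.
move=> j; apply: (@le_trans _ _ (\sum_(l < n) 2 * e)).
  apply: ler_sum => l _; have := small (delta_mx l ord0).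
  rewrite -colE; set M := word_product _ _.
  have := ler_entry_norm (col l M) j ord0.
  rewrite mxE => u1 u2; apply: le_trans u1 (le_trans u2 _).
  rewrite ler_piMr ?mulr_ge0 ?(ltW e0)//.
  apply: ler_norm_entry => // p q; rewrite mxE.
  by case: (_ && _); rewrite ?normr1 ?normr0.
rewrite sumr_const card_ord -[leLHS]mulr_natl /e.
rewrite (_ : n%:R * _ = 2^-1 * (n%:R / (n%:R + 1))); last by field; rewrite lt0r_neq0.
by rewrite ger_pMr// ler_pdivrMr// mul1r lerDl.
Qed.

End EulerDiscretization.

(** * The exponential of a matrix *)

Section DerivativeOfMatrices.
Variables (R : realType) (V : normedModType R) (p q : nat).
Implicit Types (M : V -> 'M[R]_(p, q)) (D : 'M[R]_(p, q)).

Lemma is_derive_mx M D t v :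
  (forall i j, is_derive t v (fun x => M x i j) (D i j)) -> is_derive t v M D.
Proof.
move=> MD; have Mt : derivable M t v by apply/derivable_mxP => i j; have [] := MD i j.
split => //; rewrite derive_mx//; apply/matrixP => i j; rewrite mxE.
by have [] := MD i j.
Qed.

Lemma is_derive_entry M D t v i j :
  is_derive t v M D -> is_derive t v (fun x => M x i j) (D i j).
Proof.
move=> [Mt <-]; split; first by move/derivable_mxP : Mt; exact.
by rewrite derive_mx// mxE.
Qed.

End DerivativeOfMatrices.

Section MatrixExponential.
Variables (R : realType) (n : nat) (A : 'M[R]_n).

Fixpoint matrix_power (k : nat) : 'M[R]_n :=
  if k is k'.+1 then matrix_power k' *m A else 1%:M.

Lemma matrix_power_comm k : A *m matrix_power k = matrix_power k *m A.
Proof.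
by elim: k => [|k IH] /=; [rewrite mulmx1 mul1mx|rewrite mulmxA IH].
Qed.

(** Coefficient of t ^ k in the entry (i, j) of exp (t A) Q. The factor Q lets
    the derivative, which corresponds to A Q, be treated on the same footing. *)
Definition exp_term (Q : 'M[R]_n) i j (k : nat) : R :=
  (matrix_power k *m Q) i j / k`!%:R.

Lemma pseries_diffs_exp_term Q i j :
  pseries_diffs (exp_term Q i j) = exp_term (A *m Q) i j.
Proof.
apply/funext => k; rewrite /pseries_diffs /exp_term /= factS natrM invfM -mulmxA.
by rewrite mulrCA mulVKf ?pnatr_eq0.
Qed.

Lemma is_cvg_exp_term Q i j (t : R) : cvgn (pseries (exp_term Q i j) t).
Proof.
pose a := n%:R * `|A|.
have a0 : 0 <= a by rewrite mulr_ge0.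
have pw k : `|matrix_power k| <= a ^+ k.
  elim: k => [|k IH] /=.
    apply: ler_norm_entry => // k l; rewrite mxE.
    by case: (_ == _); rewrite ?normr1 ?normr0.
  rewrite (le_trans (norm_mulmx _ _))// exprSr /a mulrAC [X in _ <= X]mulrC.
  by rewrite ler_wpM2l.
apply: normed_cvg.
apply: (@series_le_cvg _ _ (fun k => n%:R * `|Q| * exp_coeff (a * `|t|) k)) => [k|k|k|].
- exact: normr_ge0.
- by apply: mulr_ge0; [exact: mulr_ge0|apply: exp_coeff_ge0; exact: mulr_ge0].
- rewrite /= /exp_term normrM normrX normrM normfV [`|_%:R|]ger0_norm//.
  rewrite /exp_coeff /= exprMn mulrAC !mulrA ler_wpM2r ?invr_ge0//.
  rewrite ler_wpM2r ?exprn_ge0//.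
  rewrite (le_trans (ler_entry_norm _ _ _))// (le_trans (norm_mulmx _ _))//.
  by rewrite mulrAC ler_wpM2l ?mulr_ge0.
- apply: is_cvg_seriesZ; exact: is_cvg_series_exp_coeff.
Qed.

Definition exp_mx_mul (Q : 'M[R]_n) (t : R) : 'M[R]_n :=
  \matrix_(i, j) limn (pseries (exp_term Q i j) t).

Definition exp_mx := exp_mx_mul 1%:M.

Lemma exp_mx_mulE Q t : exp_mx_mul (A *m Q) t = A *m exp_mx_mul Q t.
Proof.
apply/matrixP => i j; rewrite !mxE; apply/cvg_lim => //.
have -> : pseries (exp_term (A *m Q) i j) t =
    (fun k => \sum_l A i l * pseries (exp_term Q l j) t k).
  apply/funext => k; rewrite /pseries /series /=.
  under [RHS]eq_bigr => l _ do rewrite mulr_sumr.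
  rewrite exchange_big /=; apply: eq_bigr => r _.
  rewrite /exp_term mulmxA -matrix_power_comm -mulmxA mxE.
  by rewrite !mulr_suml; apply: eq_bigr => l _; rewrite !mulrA.
under [X in _ --> X]eq_bigr => l _ do rewrite mxE.
apply: cvg_big => [|l _]; first exact: add_continuous.
apply: cvgMl_tmp; exact: is_cvg_exp_term.
Qed.

Lemma exp_mx0 : exp_mx 0 = 1%:M.
Proof.
apply/matrixP => i j; rewrite !mxE; apply/cvg_lim => //.
rewrite -cvg_shiftS /=.
rewrite (_ : (fun _ => _) = (fun=> (i == j)%:R)); first exact: cvg_cst.
apply/funext => k; rewrite /pseries /series /= big_nat_recl//= big1 ?addr0.
  by rewrite expr0 mulr1 /exp_term /= mul1mx divr1 mxE.
by move=> l _; rewrite exprS mul0r mulr0.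
Qed.

Lemma is_derive_exp_mx (t : R) : is_derive t 1 exp_mx (A *m exp_mx t).
Proof.
apply: is_derive_mx => i j.
rewrite -exp_mx_mulE [X in is_derive _ _ X _](_ : _ =
  fun x => limn (pseries (exp_term 1%:M i j) x)); last by apply/funext => x; rewrite mxE.
rewrite mxE -pseries_diffs_exp_term.
apply: (@pseries_snd_diffs _ _ (`|t| + 1)); rewrite ?pseries_diffs_exp_term;
  try exact: is_cvg_exp_term.
by rewrite [ltRHS]ger0_norm ?addr_ge0// ltrDl.
Qed.

Lemma exp_mx_first_order (e : R) : 0 < e -> exists N0 : nat, forall N,
  (N0 <= N)%N -> `|exp_mx N.+1%:R^-1 - (1%:M + N.+1%:R^-1 *: A)| <= e / N.+1%:R.
Proof.
move=> e0; have [D0 DE] := is_derive_exp_mx 0.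
have /cvgrPdist_le/(_ e e0) : h^-1 *: (exp_mx (h *: 1 + 0) - exp_mx 0) @[h --> 0^'] --> A.
  by move: D0; rewrite -[X in _ --> X](mulmx1 A) -exp_mx0 -DE.
move=> /nbhs_ballP[d /= d0 dA].
exists (Num.truncn d^-1) => N dN.
have N0 : 0 < N.+1%:R^-1 :> R by rewrite invr_gt0.
have := dA N.+1%:R^-1; rewrite /ball /= sub0r normrN gtr0_norm//.
have Nd : N.+1%:R^-1 < d.
  rewrite invf_plt ?posrE//; apply: lt_le_trans (truncnS_gt _) _.
  by rewrite ler_nat ltnS.
move=> /(_ Nd (lt0r_neq0 N0)); rewrite invrK exp_mx0 addr0 [_ *: 1]mulr1 => le_e.
rewrite ler_pdivlMr// -[leLHS]mulrC -[X in X * _]ger0_norm// -normrZ.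
rewrite (_ : _ *: _ = - (A - N.+1%:R *: (exp_mx N.+1%:R^-1 - 1%:M))) ?normrN//.
by rewrite opprD addrA scalerBr scalerA mulfV ?lt0r_neq0// scale1r opprB.
Qed.

End MatrixExponential.

(** * Trajectories of the switched system *)

Section TrajectoryPieces.
Variables (R : realType) (n : nat).
Implicit Types (f : R -> 'cV[R]_n) (M : 'M[R]_n).

Lemma is_derive_mulmxr (E : R -> 'M[R]_n) D (z : 'cV[R]_n) (t : R) :
  is_derive t 1 E D -> is_derive t 1 (fun u => E u *m z) (D *m z).
Proof.
move=> ED; apply: is_derive_mx => i j.
have -> : (fun u => (E u *m z) i j) = \sum_k (z k j \*: (fun u => E u i k)).
  apply/funext => u; rewrite mxE fct_sumE; apply: eq_bigr => k _ /=.
  by rewrite mulrC.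
have Eik k : is_derive t 1 (fun u => E u i k) (D i k) by exact: is_derive_entry.
apply: is_derive_eq; rewrite mxE; apply: eq_bigr => k _.
by rewrite mulrC.
Qed.

Lemma is_derive_translate (V : normedModType R) (f : R -> V) D (t c : R) :
  is_derive (t - c) 1 f D -> is_derive t 1 (fun u => f (u - c)) D.
Proof.
have e : (fun h => h^-1 *: (f (h *: 1 + (t - c)) - f (t - c))) =
  (fun h => h^-1 *: (f (h *: 1 + t - c) - f (t - c))).
  by apply/funext => h; rewrite addrA.
by move=> [ft <-]; split; [rewrite /derivable -e|rewrite /derive e].
Qed.

Definition lipschitz_between (V : normedModType R) (f : R -> V) (a b : R) :=
  exists2 L : R, 0 <= L &
  forall u v, a <= u -> u <= v -> v <= b -> `|f v - f u| <= L * (v - u).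

Lemma lipschitz_between_cat (V : normedModType R) (f : R -> V) a b c :
  lipschitz_between f a b -> lipschitz_between f b c ->
  lipschitz_between f a c.
Proof.
move=> [L L0 fL] [L' L'0 fL']; exists (L + L'); first exact: addr_ge0.
move=> u v au uv vc.
have [vb|bv] := leP v b.
  rewrite (le_trans (fL _ _ au uv vb))// ler_wpM2r ?subr_ge0//; lra.
have [bu|ub] := leP b u.
  rewrite (le_trans (fL' _ _ bu uv vc))// ler_wpM2r ?subr_ge0//; lra.
rewrite (_ : f v - f u = (f v - f b) + (f b - f u)); last by rewrite addrA subrK.
rewrite (le_trans (ler_normD _ _))//.
have := fL _ _ au (ltW ub) (lexx b); have := fL' _ _ (lexx b) (ltW bv) vc.
move=> h1 h2; rewrite (le_trans (lerD h1 h2))//.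
have h3 : 0 <= L * (v - b) by rewrite mulr_ge0// subr_ge0 ltW.
have h4 : 0 <= L' * (b - u) by rewrite mulr_ge0// subr_ge0 ltW.
lra.
Qed.

Lemma absolutely_continuous_lipschitz (V : normedModType R) (f : R -> V) a b :
  lipschitz_between f a b -> absolutely_continuous_on f a b.
Proof.
move=> [L L0 fL] e e0; have L1 : 0 < L + 1 by rewrite ltr_wpDl.
exists (e / (L + 1)); first by rewrite divr_gt0.
move=> N u v uv _ suv.
apply: (@le_lt_trans _ _ ((L + 1) * \sum_i (v i - u i))).
  rewrite mulr_sumr; apply: ler_sum => i _; have [au [ui vb]] := uv i.
  rewrite (le_trans (fL _ _ au ui vb))// ler_wpM2r ?subr_ge0//; lra.
by rewrite mulrC -ltr_pdivlMr.
Qed.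

(** The derivative M f is itself continuous, hence bounded on the segment. *)
Lemma lipschitz_linear_ode f M (a b : R) : a <= b ->
  (forall t : R, is_derive t 1 f (M *m f t)) -> lipschitz_between f a b.
Proof.
move=> ab fM.
have fi i (t : R) : is_derive t 1 (fun u => f u i ord0) ((M *m f t) i ord0).
  exact: is_derive_entry.
have fM2 i (t : R) :
    is_derive t 1 (fun u => (M *m f u) i ord0) ((M *m (M *m f t)) i ord0).
  have -> : (fun u => (M *m f u) i ord0) = \sum_k (M i k \*: (fun u => f u k ord0)).
    by apply/funext => u; rewrite mxE fct_sumE.
  by apply: is_derive_eq; rewrite [in RHS]mxE.
have /choice [B BP] i : exists B : R, forall t, a <= t <= b -> `|(M *m f t) i ord0| <= B.
  have [|c _ cP] := @EVT_max R (fun t => `|(M *m f t) i ord0|) a b ab.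
    apply: continuous_subspaceT => t; apply: continuous_comp; last exact: norm_continuous.
    by apply: differentiable_continuous; apply/derivable1_diffP; have [] := fM2 i t.
  by exists `|(M *m f c) i ord0| => t tab; apply: cP; rewrite in_itv.
have B0 i : 0 <= B i by rewrite (le_trans _ (BP i a _)) ?lexx.
exists (\sum_i B i) => [|u v au uv vb]; first exact: sumr_ge0.
apply: ler_norm_entry; first by rewrite mulr_ge0 ?subr_ge0// sumr_ge0.
move=> i j; rewrite (ord1 j) !mxE.
have [|c cuv ->] := @MVT_segment R (fun t => f t i ord0)
    (fun t => (M *m f t) i ord0) u v uv (fun t _ => fi i t).
  apply: continuous_subspaceT => t.
  by apply: differentiable_continuous; apply/derivable1_diffP; have [] := fi i t.
rewrite normrM [X in _ * X]ger0_norm ?subr_ge0// ler_wpM2r ?subr_ge0//.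
move: cuv; rewrite in_itv /= => /andP[uc cv].
rewrite (le_trans (BP i c _)) ?(le_trans au uc) ?(le_trans cv vb)//.
by rewrite (bigD1 i)//= lerDl sumr_ge0.
Qed.

Lemma sub_convex_hull (V : lmodType R) (S : set V) : S `<=` convex_hull S.
Proof. exact: sub_smallest. Qed.

End TrajectoryPieces.

Section SwitchedTrajectory.
Variables (R : realType) (n m : nat) (A : 'I_m -> 'M[R]_n).
Variables (s : nat -> 'I_m) (d : nat -> R) (z : nat -> 'cV[R]_n).
Hypothesis d_gt0 : forall j, 0 < d j.
Let tau j := \sum_(l < j) d l.
Hypothesis tau_unbounded : forall t, exists j, t < tau j.
Hypothesis zS : forall j, z j.+1 = exp_mx (A (s j)) (d j) *m z j.

Let tauS j : tau j.+1 = tau j + d j.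
Proof. by rewrite /tau big_ord_recr. Qed.

Let tau_lt j : tau j < tau j.+1.
Proof. by rewrite tauS ltrDl. Qed.

Let tau_le j k : (j <= k)%N -> tau j <= tau k.
Proof.
by move/subnK <-; elim: (k - j)%N => // l IH; rewrite (le_trans IH)// ltW.
Qed.

Let tau_next t : exists j, t < tau j.+1.
Proof. by have [j tj] := tau_unbounded t; exists j; exact: lt_trans tj (tau_lt j). Qed.

Let idx t := ex_minn (tau_next t).

Let idxE t j : tau j <= t -> t < tau j.+1 -> idx t = j.
Proof.
rewrite /idx; case: ex_minnP => k tk kP jt tj.
apply/eqP; rewrite eqn_leq kP//= leqNgt; apply/negP => kj.
by have := le_lt_trans jt tk; rewrite ltNge tau_le.
Qed.

Let x t := exp_mx (A (s (idx t))) (t - tau (idx t)) *m z (idx t).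
Let piece j t := exp_mx (A (s j)) (t - tau j) *m z j.

Let x_tau j : x (tau j) = z j.
Proof. by rewrite /x (idxE (lexx _))// subrr exp_mx0 mul1mx. Qed.

Let xE j t : tau j <= t -> t <= tau j.+1 -> x t = piece j t.
Proof.
move=> jt; rewrite le_eqVlt => /predU1P[->|tj]; last by rewrite /x (idxE jt tj).
by rewrite x_tau zS /piece tauS addrAC subrr add0r.
Qed.

Let piece_derive j (t : R) : is_derive t 1 (piece j) (A (s j) *m piece j t).
Proof.
rewrite /piece mulmxA; apply: is_derive_mulmxr.
apply: (@is_derive_translate _ _ (exp_mx (A (s j)))); exact: is_derive_exp_mx.
Qed.

Let x_lipschitz j : lipschitz_between x 0 (tau j).
Proof.
elim: j => [|j IH].
  exists 0 => // u v u0 uv; rewrite /tau big_ord0 => v0.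
  by rewrite (_ : u = v) ?subrr ?normr0 ?mulr0//; lra.
apply: lipschitz_between_cat IH _.
have [L L0 pL] := @lipschitz_linear_ode R n (piece j) (A (s j)) _ _
  (ltW (tau_lt j)) (piece_derive j).
exists L => // u v u0 uv v1.
rewrite !(@xE j)//; [exact: pL|exact: le_trans uv v1|exact: le_trans u0 uv].
Qed.

(** The solution follows exp (u A_(s j)) on the interval [tau_j, tau_(j+1)].
    It is Lipschitz on compact intervals by gluing, and differentiable outside
    the countable set of switching times. *)
Lemma switched_trajectory : exists2 y, inclusion_solution A y &
  forall j, y (tau j) = z j.
Proof.
exists x => //; split.
  move=> T T0; have [j Tj] := tau_unbounded T.
  have [L L0 xL] := x_lipschitz j.
  apply: absolutely_continuous_lipschitz; exists L => // u v u0 uv vT.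
  by apply: xL => //; exact: le_trans vT (ltW Tj).
have tau_countable : countable (range tau) by exact: card_image_le.
exists (range tau); split.
- exact: countable_measurable.
- exact: countable_lebesgue_measure0.
move=> t /=; apply: contra_notP => nt t0.
have tj := ex_minnP (tau_next t); rewrite -/(idx t) in tj.
set j := idx t in tj.
have jt : tau j < t.
  rewrite lt_neqAle; apply/andP; split; first by apply/eqP => jt; apply: nt; exists j.
  case: tj => -[|j' _ jP]; first by rewrite /tau big_ord0 ltW.
  rewrite leNgt; apply/negP => tj'; by have := jP j' tj'; rewrite ltnn.
have {}tj : t < tau j.+1 by case: tj.
exists (A (s j)); first by apply: sub_convex_hull; exists (s j).
rewrite (@xE j _ (ltW jt) (ltW tj)).
apply: near_eq_is_derive (piece_derive j t).
near=> u; apply/esym/xE; apply: ltW; near: u.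
  exact: lt_nbhsr.
exact: lt_nbhsl.
Unshelve. all: by end_near. Qed.

End SwitchedTrajectory.

(** * From asymptotic stability to a polynomial *)

Section StabilityToPolynomial.
Variables (R : realType) (n m : nat) (A : 'I_m -> 'M[R]_n).

Definition hold_map (p : 'I_m * nat) : 'M[R]_n := exp_mx (A p.1) p.2.+1%:R^-1.

(** The switching sequence is only accessible through its finite prefixes w,
    which is the form in which words of letters are concatenated below. *)
Lemma letters_trajectory (s : nat -> 'I_m * nat) (x0 : 'cV[R]_n) :
  (forall t : R, exists2 w, t < duration R w &
     forall p0 j, (j < size w)%N -> nth p0 w j = s j) ->
  exists2 y, inclusion_solution A y &
    forall w, (forall p0 j, (j < size w)%N -> nth p0 w j = s j) ->
      y (duration R w) = word_product hold_map w *m x0.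
Proof.
move=> sinf.
pose z := fix z j := if j is j'.+1 then hold_map (s j') *m z j' else x0.
pose d j : R := (s j).2.+1%:R^-1.
have prefix w : (forall p0 j, (j < size w)%N -> nth p0 w j = s j) ->
    duration R w = \sum_(l < size w) d l /\ z (size w) = word_product hold_map w *m x0.
  elim/last_ind: w => [|w p IH] ws.
    by rewrite /duration big_nil big_ord0 /= mul1mx.
  have [|dw zw] := IH.
    move=> p0 j jw; rewrite -(ws p0) ?size_rcons 1?ltnW ?ltnS//.
    by rewrite nth_rcons jw.
  have sp : s (size w) = p.
    by rewrite -(ws p) ?size_rcons// nth_rcons ltnn eqxx.
  rewrite size_rcons -cats1 word_product_cat /= zw mul1mx sp mulmxA; split => //.
  by rewrite /duration big_cat big_seq1 big_ord_recr /= -dw /d sp.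
have [|||y Ay yz] := @switched_trajectory R n m A (fun j => (s j).1) d z.
- by move=> j; rewrite invr_gt0 ltr0n.
- move=> t; have [w tw ws] := sinf t; exists (size w).
  by have [<-] := prefix w ws.
- by [].
exists y => // w /prefix[dw zw].
by rewrite dw yz zw.
Qed.

Hypothesis stable : asymptotically_stable A.

(** By linearity, the stability estimate at level 1 bounds every product of
    exponentials; a finite word is extended by repeating its first letter. *)
Lemma hold_map_bounded : exists2 K : R, 0 < K &
  forall w (x : 'cV[R]_n), `|word_product hold_map w *m x| <= K * `|x|.
Proof.
have [d d0 dP] := stable.1 1 ltr01.
exists (2 / d + 1); first by rewrite ltr_wpDl// divr_ge0// ltW.
case=> [|p w] x.
  by rewrite /= mul1mx ler_peMl// lerDr divr_ge0// ltW.
have [->|x0] := eqVneq x 0; first by rewrite mulmx0 normr0 mulr0.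
have nx : 0 < `|x| by rewrite normr_gt0.
(* c x has norm d / 2 < d. *)
pose c := d / (2 * `|x|).
have c0 : 0 < c by rewrite divr_gt0// mulr_gt0.
have [|y Ay yw] := @letters_trajectory (nth p (p :: w)) (c *: x).
  move=> t; have p20 : 0 < p.2.+1%:R^-1 :> R by rewrite invr_gt0.
  exists ((p :: w) ++ nseq (Num.bound (`|t| * p.2.+1%:R)) p).
    rewrite /duration big_cat ltr_wpDl//.
      by apply: sumr_ge0 => q _; rewrite invr_ge0.
    rewrite big_nseq iter_addr addr0 -[ltRHS]mulr_natl ltr_pdivlMr//.
    apply: le_lt_trans (archi_boundP _); last by rewrite mulr_ge0.
    by rewrite ler_wpM2r// ler_norm.
  move=> p0 j jw; rewrite (set_nth_default p) // nth_cat nth_nseq.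
  by case: ltnP => // jw'; rewrite if_same nth_default.
have /= yw1 := yw (p :: w); rewrite -/(word_product _ (p :: w)) in yw1.
have y0 : y 0 = c *: x.
  by have := yw [::]; rewrite /duration big_nil mul1mx; apply.
have : `|y (duration R (p :: w))| < 1.
  apply: dP Ay _ _ _.
    rewrite y0 normrZ gtr0_norm// /c invfM mulrA mulfVK ?lt0r_neq0//.
    by rewrite gtr_pMr// invf_lt1// ltr1n.
  by apply: sumr_ge0 => q _; rewrite invr_ge0.
rewrite yw1 => [|p0 j jw]; last exact: set_nth_default.
rewrite -scalemxAr normrZ gtr0_norm// -ltr_pdivlMl// mulr1 => /ltW h1.
apply: le_trans h1 _; rewrite /c invf_div -mulrA [`|x| / d]mulrC mulrA.
by rewrite ler_wpM2r// lerDl.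
Qed.

(** Infinitely many words of duration 1 are flattened into one switching
    sequence, whose trajectory passes through x k at time k and tends to 0. *)
Lemma hold_map_decay (w : nat -> seq ('I_m * nat)) (x : nat -> 'cV[R]_n) :
  (forall k, duration R (w k) = 1) ->
  (forall k, x k.+1 = word_product hold_map (w k) *m x k) ->
  forall e : R, 0 < e -> exists k, `|x k| < e.
Proof.
move=> w1 xS e e0.
pose W k := flatten (mkseq w k).
have WS k : W k.+1 = W k ++ w k by rewrite /W mkseqS flatten_rcons.
have w_gt0 k : (0 < size (w k))%N.
  rewrite lt0n size_eq0; apply/eqP => wk; have := w1 k.
  by rewrite wk /duration big_nil => /eqP; rewrite eq_sym oner_eq0.
have W_size k : (k <= size (W k))%N.
  elim: k => // k IH; rewrite WS size_cat (leq_ltn_trans IH)//.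
  by rewrite -{1}[size (W k)]addn0 ltn_add2l.
have W_dur k : duration R (W k) = k%:R.
  elim: k => [|k IH]; first by rewrite /duration big_nil.
  by rewrite WS /duration big_cat /= -!/(duration _ _) IH w1 natr1.
have W_nth p0 k l j : (k <= l)%N -> (j < size (W k))%N -> nth p0 (W l) j = nth p0 (W k) j.
  move=> /subnK <- jk; elim: (l - k)%N => // i IH.
  have ji : (j < size (W (i + k)))%N.
    rewrite (leq_trans jk)//; elim: i {IH} => // i IH.
    by rewrite addSn WS size_cat (leq_trans IH)// leq_addr.
  by rewrite addSn WS nth_cat ji.
have [p0 _] : exists p0 : 'I_m * nat, True.
  by case: (w 0%N) (w_gt0 0%N) => // p0 *; exists p0.
pose s j := nth p0 (W j.+1) j.
have Ws k p j : (j < size (W k))%N -> nth p (W k) j = s j.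
  move=> jk; rewrite (set_nth_default p0)// /s.
  have [kj|jk'] := leqP k j.+1; first by rewrite (W_nth _ _ _ _ kj).
  by rewrite (W_nth _ _ _ _ (ltnW jk'))// W_size.
have [|y Ay yW] := @letters_trajectory s (x 0%N).
  move=> t; exists (W (Num.bound `|t|)); last by move=> p j; exact: Ws.
  rewrite W_dur; exact: le_lt_trans (ler_norm _) (archi_boundP (normr_ge0 _)).
have yk k : y k%:R = x k.
  rewrite -W_dur yW => [|p j]; last exact: Ws.
  elim: k => [|k IH]; first by rewrite mul1mx.
  by rewrite WS word_product_cat -mulmxA IH xS.
have /cvgrPdist_lt/(_ e e0)[M [_ yM]] := stable.2 y Ay.
exists (Num.bound `|M|); rewrite -yk -normrN -[- _]add0r; apply: yM.
exact: le_lt_trans (ler_norm _) (archi_boundP (normr_ge0 _)).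
Qed.

Lemma common_polynomial_of_stable : has_common_sos_lyapunov A.
Proof.
have [K K0 FK] := hold_map_bounded.
have [|h [L [h0 hL]]] := @contractive_euler R n m A hold_map K K0 _ FK hold_map_decay.
  move=> e e0; have /choice[N NP] i := exp_mx_first_order (A i) e0.
  exists (\max_i N i) => i k Nk; apply: (NP i).
  exact: leq_trans (leq_bigmax _) Nk.
exact: common_polynomial_of_contractive h0 hL.
Qed.

End StabilityToPolynomial.

(** * Absolutely continuous functions with nonpositive derivative *)

Section AbsolutelyContinuousMonotone.
Variables (R : realType) (f : R -> R) (a b : R).
Hypothesis ab : a <= b.
Hypothesis f_ac : absolutely_continuous_on f a b.

Section Cover.
Variables (O : set R) (e : R).
Hypothesis O_open : open O.
Hypothesis e_gt0 : 0 < e.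

(** A gauge r at t. With O a small open neighbourhood of the exceptional
    points, the first alternative serves at the other points, where the
    derivative of f is nonpositive. *)
Definition locally_controlled (t r : R) := forall u v : R,
  a <= u -> u <= t -> t <= v -> v <= b -> t - r < u -> v < t + r ->
  f v - f u <= e * (v - u) \/ `]u, v[%classic `<=` O.

Local Notation mu := (@lebesgue_measure R).

(** The growth of f on [a, t] is accounted for by the slope e and by its
    increments over disjoint intervals whose total length is at most the
    measure of O on the left of t. Recording this bound, rather than the
    inclusion of the intervals in O, makes the extension step an instance of
    additivity. *)
Definition increase_covered (t : R) := exists (N : nat) (u v : 'I_N -> R),
  [/\ forall i, a <= u i /\ u i <= v i /\ v i <= t,
      trivIset setT (fun i => `]u i, v i[%classic),
      ((\sum_i (v i - u i))%:E <= mu (O `&` `]a, t[%classic))%E &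
      f t - f a <= e * (t - a) + \sum_i (f (v i) - f (u i))].

Lemma increase_covered_start : increase_covered a.
Proof.
exists 0%N, (fun=> a), (fun=> a); split => [[]//|[]//||].
  by rewrite big_ord0.
by rewrite big_ord0 !subrr mulr0 addr0.
Qed.

Let measurable_part t : measurable (O `&` `]a, t[%classic).
Proof. by apply: measurableI => //; exact: open_measurable. Qed.

Let le_mu (X Y : set R) : measurable X -> measurable Y -> X `<=` Y -> (mu X <= mu Y)%E.
Proof. move=> mX mY XY; apply: (le_measure mu); rewrite ?inE //.
Qed.

Lemma increase_covered_step (u v : R) : a <= u -> u <= v ->
  f v - f u <= e * (v - u) \/ `]u, v[%classic `<=` O ->
  increase_covered u -> increase_covered v.
Proof.
move=> au uv [fuv|uvO] [N [p [q [pq pqI pqO fu]]]].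
  exists N, p, q; split => //.
  - by move=> i; have [ap [pqi qu]] := pq i; split => //; split => //; exact: le_trans uv.
  - apply: le_trans pqO (le_mu _ _ _) => //.
    by apply: setIS => x /=; rewrite !in_itv /= => /andP[-> /lt_le_trans]; exact.
  - lra.
(* The interval ]u, v[ is put at index 0, the other ones are shifted. *)
pose ext (w : R) (g : 'I_N -> R) (i : 'I_N.+1) :=
  if unlift ord0 i is Some j then g j else w.
have ext0 w g : ext w g ord0 = w by rewrite /ext unlift_none.
have extS w g i : ext w g (lift ord0 i) = g i by rewrite /ext liftK.
exists N.+1, (ext u p), (ext v q); split.
- move=> i; case: (unliftP ord0 i) => [j|] ->; rewrite ?extS ?ext0//.
  by have [ap [pqi qu]] := pq j; split => //; split => //; exact: le_trans uv.
- have disj j y : ~ (`]u, v[%classic y /\ `]p j, q j[%classic y).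
    rewrite /= !in_itv /= => -[/andP[uy _] /andP[_ yq]].
    by have [_ [_ qu]] := pq j; have := lt_trans yq (le_lt_trans qu uy); rewrite ltxx.
  move=> i j _ _ [y []].
  case: (unliftP ord0 i) => [i'|] ->; case: (unliftP ord0 j) => [j'|] ->;
    rewrite ?extS ?ext0 => yi yj //.
  + by congr (lift _ _); apply: pqI => //; exists y.
  + by exfalso; apply: (disj i' y).
  + by exfalso; apply: (disj j' y).
- rewrite big_ord_recl ext0 [X in _ + X](_ : _ = \sum_i (q i - p i)); last first.
    by apply: eq_bigr => i _; rewrite ext0 !extS || rewrite !extS.
  rewrite EFinD.
  have muv : mu `]u, v[%classic = (v - u)%:E.
    rewrite lebesgue_measure_itv /= lte_fin; case: ltP => // vu.
    by rewrite (_ : v = u) ?subrr//; apply/le_anti/andP.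
  rewrite ext0 addeC -muv; apply: le_trans (leeD2r _ pqO) _.
  have <- : (mu (O `&` `]a, u[ `|` `]u, v[) = mu (O `&` `]a, u[) + mu `]u, v[)%E.
    apply: measureU; [exact: measurable_part|by []|].
    apply/seteqP; split => // y /= [[_]].
    rewrite !in_itv /= => /andP[_ yu] /andP[uy _].
    by have := lt_trans yu uy; rewrite ltxx.
  apply: le_mu; [by apply: measurableU|exact: measurable_part|].
  move=> y [[Oy]|uvy].
    rewrite /= !in_itv /= => /andP[ay yu]; split => //=.
    by rewrite ay (lt_le_trans yu).
  split; first exact: uvO.
  by move: uvy; rewrite /= !in_itv /= => /andP[uy ->]; rewrite (le_lt_trans au).
- rewrite big_ord_recl !ext0.
  rewrite [X in _ + (_ + X)](_ : _ = \sum_i (f (q i) - f (p i))); last first.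
    by apply: eq_bigr => i _; rewrite !extS.
  have : 0 <= e * (v - u) by rewrite mulr_ge0 ?subr_ge0// ltW.
  lra.
Qed.

(** Continuous induction: the supremum of the reachable points is reached and
    passed, by local control at that point. *)
Lemma increase_covered_end :
  (forall t, a <= t -> t <= b -> exists2 r, 0 < r & locally_controlled t r) ->
  increase_covered b.
Proof.
move=> loc; pose S := [set t | [/\ a <= t, t <= b & increase_covered t]].
have Sa : S a by split => //; exact: increase_covered_start.
have Sb : has_ubound S by exists b => t [].
have hS : has_sup S by split => //; exists a.
set sg := sup S.
have asg : a <= sg by exact: ub_le_sup.
have sgb : sg <= b by apply: ge_sup; [exists a|move=> t []].
have [r r0 rP] := loc sg asg sgb.
have [u [au ub Qu] sru] := sup_adherent r0 hS.
have usg : u <= sg by apply: ub_le_sup.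
(* v lies to the right of sg, unless sg = b. *)
pose v := Num.min b (sg + r / 2).
have sgv : sg <= v by rewrite le_min sgb lerDl divr_ge0// ltW.
have vb : v <= b by rewrite ge_min lexx.
have Qv : increase_covered v.
  apply: increase_covered_step Qu => //; first exact: le_trans sgv.
  apply: rP => //; rewrite gt_min; apply/orP; right; rewrite ltrD2l; lra.
have vsg : v <= sg by apply: ub_le_sup => //; split => //; exact: le_trans sgv.
suff -> : b = v by [].
rewrite /v minElt; case: ltP => // sb; move: vsg; rewrite /v min_r//; lra.
Qed.

End Cover.

(** The points without a nonpositive derivative, together with a and b, form a
    null set. It is covered by an open O so small that the increments of f over
    disjoint intervals of total length at most the measure of O sum to less
    than e. Elsewhere the slope is locally at most e. So f b - f a is at most
    e (b - a + 1), for every e > 0. *)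
Lemma ac_nonincreasing :
  {ae (@lebesgue_measure R), forall t : R, a < t -> t < b ->
     exists2 D : R, D <= 0 & is_derive t 1 f D} ->
  f b <= f a.
Proof.
move=> [Z [mZ Z0 fZ]]; rewrite leNgt; apply/negP => fab.
pose e := (f b - f a) / (b - a + 2).
have ba : 0 < b - a + 2 by rewrite ltr_wpDl// subr_ge0.
have e0 : 0 < e by rewrite divr_gt0// subr_gt0.
have [d d0 dP] := f_ac e0.
pose Z' := Z `|` [set a] `|` [set b].
have mZa : measurable (Z `|` [set a]) by apply: measurableU.
have mZ' : measurable Z' by apply: measurableU.
have Z'0 : lebesgue_measure Z' = 0%E.
  rewrite /Z' measureU0//; last exact: lebesgue_measure_set1.
  by rewrite measureU0//; exact: lebesgue_measure_set1.
have Zfinite : (lebesgue_measure Z' < +oo)%E by rewrite Z'0.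
have [|O [Oo Z'O OZ]] := lebesgue_regularity_outer mZ' _ d0; first exact: Zfinite.
have mO : measurable O by exact: open_measurable.
have muO : (lebesgue_measure O < d%:E)%E.
  have -> : lebesgue_measure O =
      (lebesgue_measure (O `\` Z') + lebesgue_measure (O `&` Z'))%E.
    exact: measureDI.
  by rewrite (setIidr Z'O) Z'0 adde0.
have [|N [u [v [uv uvI uvO fb]]]] := @increase_covered_end O e Oo e0 _.
  move=> t at_ tb.
  have [Ot|nOt] := pselect (O t).
    have /nbhs_ballP[r /= r0 rO] : nbhs t O by exact: open_nbhs_nbhs.
    exists r => // u v au ut tv vb tru vtr; right => y /=.
    rewrite in_itv /= => /andP[uy yv]; apply: rO; rewrite /ball /= ltr_norml.
    by apply/andP; split; lra.
  have nZ't : ~ Z' t by move=> /Z'O.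
  have [D D0 Dt] : exists2 D : R, D <= 0 & is_derive t 1 f D.
    apply: contrapT => nD; apply: (nZ't); do 2 left; apply: fZ => /=.
    move=> h; apply: (nD); apply: h.
    - by rewrite lt_neqAle at_ andbT; apply/eqP => ta; apply: (nZ't); left; right.
    - by rewrite lt_neqAle tb andbT; apply/eqP => ta; apply: (nZ't); right.
  have : h^-1 *: (f (h *: 1 + t) - f t) @[h --> 0^'] --> D.
    by have [h1 <-] := Dt.
  move=> /cvgrPdist_le/(_ e e0)/nbhs_ballP[r /= r0 rD].
  have near_t s : `|s - t| < r -> `|f s - f t - D * (s - t)| <= e * `|s - t|.
    have [->|st] := eqVneq s t; first by rewrite !subrr mulr0 subrr normr0 mulr0.
    move=> str; have st0 : s - t != 0 by rewrite subr_eq0.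
    have := rD (s - t); rewrite /ball /= sub0r normrN => /(_ str st0).
    rewrite [_ *: 1]mulr1 subrK => h1.
    have -> : f s - f t - D * (s - t) =
        - ((s - t) * (D - (s - t)^-1 *: (f s - f t))).
      by rewrite /GRing.scale /=; field.
    by rewrite normrN normrM mulrC ler_wpM2r.
  exists r => // u v au ut tv vb tru vtr; left.
  have vt : `|v - t| = v - t by rewrite ger0_norm ?subr_ge0.
  have ut' : `|u - t| = t - u by rewrite distrC ger0_norm ?subr_ge0.
  have h1 : f v - f t - D * (v - t) <= e * (v - t).
    by apply: le_trans (ler_norm _) (le_trans (near_t v _) _); rewrite vt; lra.
  have h2 : - (f u - f t - D * (u - t)) <= e * (t - u).
    apply: le_trans (ler_norm _) _; rewrite normrN.
    by apply: le_trans (near_t u _) _; rewrite ut'; lra.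
  have h3 : D * (v - u) <= 0 by rewrite mulr_le0_ge0// subr_ge0 (le_trans ut).
  lra.
have suv : \sum_i (v i - u i) < d.
  rewrite -lte_fin; apply: le_lt_trans uvO (le_lt_trans _ muO).
  by apply: le_measure; rewrite ?inE//; apply: measurableI.
have := dP N u v uv uvI suv => h1.
have h2 : \sum_i (f (v i) - f (u i)) < e.
  apply: le_lt_trans h1; apply: ler_sum => i _; exact: ler_norm.
have h3 : e * (b - a + 2) = f b - f a by rewrite /e divfK// lt0r_neq0.
clearbody e; rewrite mulrDr in h3; clear -fb h2 h3 e0; lra.
Qed.

End AbsolutelyContinuousMonotone.

(** * Polynomials along absolutely continuous curves *)

Section PolynomialAlongCurves.
Variables (R : realType) (n : nat).
Implicit Types p q : mpoly.mpoly n R.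

(** Polynomial functions are generated by constants and coordinates under sums
    and products, so properties stable under these need no reference to
    monomials. *)
Lemma mpoly_closure_ind (P : mpoly.mpoly n R -> Prop) :
  (forall c, P (mpoly.mpolyC n c)) ->
  (forall k, P (mpoly.mpolyX R (mpoly.mnm1 k))) ->
  (forall p q, P p -> P q -> P (p + q)) ->
  (forall p q, P p -> P q -> P (p * q)) -> forall p, P p.
Proof.
move=> PC PX PD PM; elim/mpoly.mpolyind => [|c M p _ _ Pp].
  by have := PC 0; rewrite mpoly.mpolyC0.
apply: (PD) => //; rewrite -mpoly.mul_mpolyC; apply: (PM) => //.
rewrite mpoly.mpolyXE_id; elim/big_ind: _ => [||i _]; [by have := PC 1|exact: PM|].
 elim: (M i) => [|k IH]; first by have := PC 1; rewrite expr0.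
by rewrite exprS; apply: PM.
Qed.

Definition directional_derivative p (x v : 'cV[R]_n) : R :=
  \sum_j poly_eval (mpoly.mderiv j p) x * v j ord0.

Lemma directional_derivative_lie (M : 'M[R]_n) p x :
  directional_derivative p x (M *m x) = poly_eval (lie_derivative M p) x.
Proof.
rewrite /poly_eval /lie_derivative raddf_sum; apply: eq_bigr => j _ /=.
rewrite mpoly.mevalM; congr (_ * _); rewrite /linear_field raddf_sum mxE.
by apply: eq_bigr => k _ /=; rewrite mpoly.mevalZ mpoly.mevalXU.
Qed.

Lemma poly_chain_rule p (x : R -> 'cV[R]_n) (v : 'cV[R]_n) (t : R) :
  is_derive t 1 x v ->
  is_derive t 1 (fun u => poly_eval p (x u)) (directional_derivative p (x t) v).
Proof.
move=> xv; elim/mpoly_closure_ind: p => [c|k|p q IHp IHq|p q IHp IHq].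
- rewrite [X in is_derive _ _ X _](_ : _ = cst c); last first.
    by apply/funext => u; rewrite /poly_eval mpoly.mevalC.
  rewrite /directional_derivative big1; first exact: is_derive_cst.
  by move=> j _; rewrite mpoly.mderivC /poly_eval mpoly.meval0 mul0r.
- rewrite [X in is_derive _ _ X _](_ : _ = fun u => x u k ord0); last first.
    by apply/funext => u; rewrite /poly_eval mpoly.mevalXU.
  rewrite (_ : directional_derivative _ _ _ = v k ord0); first exact: is_derive_entry.
  rewrite /directional_derivative (bigD1 k)//= big1 ?addr0 => [|j jk].
    by rewrite mderiv_variable eqxx /poly_eval mpoly.meval1 mul1r.
  rewrite mderiv_variable eq_sym (negbTE jk).
  by rewrite /poly_eval mpoly.meval0 mul0r.
- rewrite [X in is_derive _ _ X _](_ : _ =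
    (fun u => poly_eval p (x u)) + (fun u => poly_eval q (x u))); last first.
    by apply/funext => u; rewrite /poly_eval mpoly.mevalD.
  apply: is_derive_eq; rewrite /directional_derivative -big_split /=.
  by apply: eq_bigr => j _; rewrite mpoly.mderivD /poly_eval mpoly.mevalD mulrDl.
- rewrite [X in is_derive _ _ X _](_ : _ =
    (fun u => poly_eval p (x u)) * (fun u => poly_eval q (x u))); last first.
    by apply/funext => u; rewrite /poly_eval mpoly.mevalM.
  apply: is_derive_eq; rewrite /directional_derivative !scaler_sumr -big_split /=.
  apply: eq_bigr => j _.
  rewrite mpoly.mderivM /poly_eval mpoly.mevalD !mpoly.mevalM /GRing.scale /=.
  ring.
Qed.

Lemma poly_eval_continuous p : continuous (poly_eval p).
Proof.
elim/mpoly_closure_ind: p => [c|k|p q IHp IHq|p q IHp IHq] x.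
- rewrite (_ : poly_eval _ = cst c); last first.
    by apply/funext => u; rewrite /poly_eval mpoly.mevalC.
  exact: cst_continuous.
- rewrite (_ : poly_eval _ = fun u => u k ord0); last first.
    by apply/funext => u; rewrite /poly_eval mpoly.mevalXU.
  exact: coord_continuous.
- rewrite (_ : poly_eval _ = poly_eval p + poly_eval q); last first.
    by apply/funext => u; rewrite /poly_eval mpoly.mevalD.
  by apply: continuousD; [exact: IHp|exact: IHq].
- rewrite (_ : poly_eval _ = poly_eval p \* poly_eval q); last first.
    by apply/funext => u; rewrite /poly_eval mpoly.mevalM.
  by apply: continuousM; [exact: IHp|exact: IHq].
Qed.

End PolynomialAlongCurves.

Section AbsoluteContinuityAlgebra.
Variables (R : realType) (a b : R).

(** Boundedness is carried along because it is what makes the product of two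
    absolutely continuous functions absolutely continuous. *)
Definition ac_bounded (f : R -> R) := absolutely_continuous_on f a b /\
  exists B : R, forall t, a <= t -> t <= b -> `|f t| <= B.

Lemma ac_bounded_dominated (V W : normedModType R) (f : R -> R) (g : R -> V)
    (h : R -> W) (K : R) :
  0 <= K -> absolutely_continuous_on g a b -> absolutely_continuous_on h a b ->
  (forall u v, a <= u -> u <= v -> v <= b ->
    `|f v - f u| <= K * (`|g v - g u| + `|h v - h u|)) ->
  absolutely_continuous_on f a b.
Proof.
move=> K0 gac hac fgh e e0.
have K1 : 0 < 2 * (K + 1) by rewrite mulr_gt0// ltr_wpDl.
have e1 : 0 < e / (2 * (K + 1)) by rewrite divr_gt0.
have [d d0 dP] := gac _ e1; have [d' d'0 d'P] := hac _ e1.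
exists (Num.min d d'); first by rewrite lt_min d0.
move=> N u v uv uvI; rewrite lt_min => /andP[sd sd'].
have h1 := dP _ _ _ uv uvI sd; have h2 := d'P _ _ _ uv uvI sd'.
apply: (@le_lt_trans _ _ ((K + 1) *
    (\sum_i `|g (v i) - g (u i)| + \sum_i `|h (v i) - h (u i)|))).
  rewrite -big_split mulr_sumr; apply: ler_sum => i _ /=; have [au [ui vb]] := uv i.
  rewrite (le_trans (fgh _ _ au ui vb))// ler_wpM2r ?addr_ge0//; lra.
rewrite mulrC -ltr_pdivlMr ?ltr_wpDl//.
rewrite (lt_le_trans (ltrD h1 h2))// le_eqVlt; apply/orP; left; apply/eqP.
by field; rewrite lt0r_neq0 ?ltr_wpDl.
Qed.

Lemma ac_bounded_cst c : ac_bounded (cst c).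
Proof.
split; last by exists `|c|.
apply: absolutely_continuous_lipschitz; exists 0 => // u v _ _ _.
by rewrite subrr normr0 mul0r.
Qed.

Lemma ac_bounded_id : ac_bounded id.
Proof.
split; last first.
  by exists (`|a| + `|b|) => t at_ tb; rewrite ler_norml; apply/andP; split;
    have := ler_norm b; have := ler_norm (- a); rewrite normrN;
    have := normr_ge0 a; have := normr_ge0 b; lra.
apply: absolutely_continuous_lipschitz; exists 1 => // u v _ uv _.
by rewrite ger0_norm ?subr_ge0// mul1r.
Qed.

Lemma ac_boundedD f g : ac_bounded f -> ac_bounded g -> ac_bounded (fun t => f t + g t).
Proof.
move=> [fac [B fB]] [gac [C gC]]; split; last first.
  exists (B + C) => t at_ tb; rewrite (le_trans (ler_normD _ _))// lerD ?fB ?gC//.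
apply: (ac_bounded_dominated ler01 fac gac) => u v _ _ _.
rewrite mul1r (le_trans _ (ler_normD _ _))//.
by rewrite le_eqVlt; apply/orP; left; apply/eqP; congr (`|_|); ring.
Qed.

Lemma ac_boundedM f g : ac_bounded f -> ac_bounded g -> ac_bounded (fun t => f t * g t).
Proof.
move=> [fac [B fB]] [gac [C gC]]; split; last first.
  exists (B * C) => t at_ tb; rewrite normrM ler_pM ?fB ?gC//.
apply: (@ac_bounded_dominated _ _ _ f g (`|B| + `|C|)) => //.
move=> u v au uv vb.
have -> : f v * g v - f u * g u = (f v - f u) * g v + f u * (g v - g u) by ring.
rewrite (le_trans (ler_normD _ _))// !normrM.
have h1 : `|g v| <= `|C| by rewrite (le_trans (gC _ _ vb))// ?ler_norm// (le_trans au).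
have h2 : `|f u| <= `|B| by rewrite (le_trans (fB _ au _))// ?ler_norm// (le_trans uv).
have h3 := normr_ge0 B; have h4 := normr_ge0 C.
have h5 : `|f v - f u| * `|g v| <= `|f v - f u| * (`|B| + `|C|).
  by rewrite ler_wpM2l//; lra.
have h6 : `|f u| * `|g v - g u| <= (`|B| + `|C|) * `|g v - g u|.
  by rewrite ler_wpM2r//; lra.
lra.
Qed.

(** A bound on the segment comes from cutting it into steps of length d / 2 < d,
    over each of which the curve moves by at most 1. *)
Lemma ac_bounded_coord (n : nat) (x : R -> 'cV[R]_n) k : a <= b ->
  absolutely_continuous_on x a b -> ac_bounded (fun t => x t k ord0).
Proof.
move=> ab xac.
have diff u v : `|x v k ord0 - x u k ord0| <= `|x v - x u|.
  by have := ler_entry_norm (x v - x u) k ord0; rewrite !mxE.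
split.
  apply: (ac_bounded_dominated ler01 xac xac) => u v _ _ _.
  by rewrite mul1r (le_trans (diff u v))// lerDl.
have [d d0 dP] := xac 1 ltr01.
have d2 : 0 < d / 2 by rewrite divr_gt0.
have near_ u v : a <= u -> u <= v -> v <= b -> v - u < d -> `|x v - x u| <= 1.
  move=> au uv vb vud; apply: ltW.
  have := dP 1%N (fun=> u) (fun=> v); rewrite !big_ord1; apply => //.
  by move=> i j _ _ _; rewrite (ord1 i) (ord1 j).
have bd (N : nat) t : a <= t -> t <= b ->
    t <= a + (d / 2) * N%:R -> `|x t| <= `|x a| + N%:R.
  elim: N t => [|N IH] t at_ tb.
    by rewrite mulr0 addr0 => ta; rewrite (_ : t = a) ?addr0//; lra.
  rewrite -[N.+1%:R]natr1 mulrDr mulr1 => tN.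
  pose u := Num.max a (t - d / 2).
  have au : a <= u by rewrite le_max lexx.
  have ut : u <= t by rewrite ge_max at_ lerBlDr lerDl ltW.
  have tu : t - u < d.
    apply: (@le_lt_trans _ _ (d / 2)); last by lra.
    by rewrite lerBlDr addrC -lerBlDr le_max lexx orbT.
  have h1 := near_ u t au ut tb tu.
  have h2 : `|x u| <= `|x a| + N%:R.
    apply: IH => //; first exact: le_trans tb.
    rewrite ge_max; apply/andP; split; last by lra.
    by rewrite lerDl mulr_ge0// ltW.
  rewrite -[x t](subrK (x u)) (le_trans (ler_normD _ _))//; lra.
pose N := Num.bound ((b - a) / (d / 2)).
exists (`|x a| + N%:R) => t at_ tb.
rewrite (le_trans (ler_entry_norm _ _ _))// bd//.
have : (b - a) / (d / 2) <= N%:R.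
  by apply/ltW/archi_boundP; rewrite divr_ge0 ?subr_ge0// ltW.
rewrite ler_pdivrMr//; lra.
Qed.

Lemma ac_bounded_poly (n : nat) (p : mpoly.mpoly n R) (x : R -> 'cV[R]_n) : a <= b ->
  absolutely_continuous_on x a b -> ac_bounded (fun t => poly_eval p (x t)).
Proof.
move=> ab xac; elim/mpoly_closure_ind: p => [c|k|p q IHp IHq|p q IHp IHq].
- rewrite (_ : (fun _ => _) = cst c); first exact: ac_bounded_cst.
  by apply/funext => u; rewrite /poly_eval mpoly.mevalC.
- rewrite (_ : (fun _ => _) = fun u => x u k ord0); first exact: ac_bounded_coord.
  by apply/funext => u; rewrite /poly_eval mpoly.mevalXU.
- rewrite (_ : (fun _ => _) = fun u => poly_eval p (x u) + poly_eval q (x u)).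
    exact: ac_boundedD.
  by apply/funext => u; rewrite /poly_eval mpoly.mevalD.
- rewrite (_ : (fun _ => _) = fun u => poly_eval p (x u) * poly_eval q (x u)).
    exact: ac_boundedM.
  by apply/funext => u; rewrite /poly_eval mpoly.mevalM.
Qed.

End AbsoluteContinuityAlgebra.

(** * Lyapunov functions imply asymptotic stability *)

Section HomogeneousBounds.
Variables (R : realType) (n : nat).

(** Differentiate p (l (y + s M y)) = l ^ d p (y + s M y) at s = 0. *)
Lemma lie_derivative_scale (p : mpoly.mpoly n R) (d : nat) (M : 'M[R]_n) (l : R) y :
  (forall (l : R) x, poly_eval p (l *: x) = l ^+ d * poly_eval p x) ->
  poly_eval (lie_derivative M p) (l *: y) = l ^+ d * poly_eval (lie_derivative M p) y.
Proof.
move=> pd.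
have line (c z : 'cV[R]_n) : is_derive (0 : R) 1 (fun s : R => c + s *: z) z.
  apply: is_derive_mx => i j.
  rewrite [X in is_derive _ _ X _](_ : _ = cst (c i j) + (z i j \*: id)); last first.
    by apply/funext => s; rewrite !mxE /= mulrC.
  by apply: is_derive_eq; rewrite add0r /GRing.scale /= mulr1.
have D1 := poly_chain_rule p (line (l *: y) (l *: (M *m y))).
have D2 := poly_chain_rule p (line y (M *m y)).
rewrite /= !scale0r !addr0 in D1 D2.
have D3 : is_derive (0 : R) 1 (fun s : R => poly_eval p (l *: y + s *: (l *: (M *m y))))
    (l ^+ d * directional_derivative p y (M *m y)).
  rewrite [X in is_derive _ _ X _](_ : _ =
    l ^+ d \*: (fun s : R => poly_eval p (y + s *: (M *m y)))); last first.
    by apply/funext => s /=; rewrite scalerA mulrC -scalerA -scalerDr pd.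
  exact: is_derive_eq.
rewrite -!directional_derivative_lie -[M *m (l *: y)]scalemxAr.
by have [_ <-] := D1; have [_ <-] := D3.
Qed.

(** Extrema on the unit sphere, then scaling. *)
Lemma homogeneous_bounds (g : 'cV[R]_n -> R) (d : nat) : (0 < d)%N -> continuous g ->
  (forall (l : R) x, g (l *: x) = l ^+ d * g x) ->
  (forall x, x != 0 -> 0 < g x) ->
  exists c C : R, [/\ 0 < c, 0 < C & forall x, c * `|x| ^+ d <= g x <= C * `|x| ^+ d].
Proof.
move=> d0 gc gh gp; pose S := [set x : 'cV[R]_n | `|x| = 1].
have [c [C [c0 C0 S1]]] : exists c C : R,
    [/\ 0 < c, 0 < C & forall x, S x -> c <= g x <= C].
  have [S0|nS] := pselect (S !=set0); last first.
    by exists 1, 1; split => // x Sx; exfalso; apply: nS; exists x.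
  have cS : compact S.
    apply: cV_bounded_closed_compact.
      exists 1; split; first exact: num_real.
      by move=> y y1 v /= ->; exact: ltW.
    apply: (@closed_comp _ _ (fun x : 'cV[R]_n => `|x|) [set x | x = 1]).
      by move=> x _; exact: norm_continuous.
    exact: closed_eq.
  have gS : {within S, continuous g} by exact: continuous_subspaceT.
  have [u uS uP] := compact_EVT_min S0 cS gS.
  have [v vS vP] := compact_EVT_max S0 cS gS.
  have pos z : z \in S -> 0 < g z.
    rewrite inE /S /= => z1; apply: gp; apply/eqP => z0.
    by move: z1; rewrite z0 normr0 => /esym/eqP; rewrite oner_eq0.
  exists (g u), (g v); split; rewrite ?pos// => x Sx.
  by rewrite uP ?vP// inE.
exists c, C; split => // x; have [->|x0] := eqVneq x 0.
  have -> : g 0 = 0 by rewrite -(scale0r 0) gh expr0n gtn_eqF// mul0r.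
  by rewrite normr0 expr0n gtn_eqF// !mulr0 lexx.
have nx : 0 < `|x| by rewrite normr_gt0.
have -> : g x = `|x| ^+ d * g (`|x|^-1 *: x).
  by rewrite -gh scalerA mulfV ?lt0r_neq0// scale1r.
rewrite ![_ * `|x| ^+ d]mulrC !ler_pM2l ?exprn_gt0//; apply: S1.
by rewrite /S /= normrZ normfV normr_id mulVf// lt0r_neq0.
Qed.

End HomogeneousBounds.

Section LyapunovStability.
Variables (R : realType) (n m : nat) (A : 'I_m -> 'M[R]_n).
Variables (W : mpoly.mpoly n R) (d : nat).
Hypothesis d_gt0 : (0 < d)%N.
Hypothesis W_scale : forall (l : R) x, poly_eval W (l *: x) = l ^+ d * poly_eval W x.
Hypothesis W_pd : positive_definite W.
Hypothesis LW_pd : forall i, positive_definite (- lie_derivative (A i) W).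

(** For a fixed x, the inequality is preserved by convex combinations of the
    matrices, so it is enough to establish it for each A_i with a common c. *)
Lemma decay_rate : exists2 c : R, 0 < c & forall M, convex_hull (range A) M ->
  forall x, poly_eval (lie_derivative M W) x <= - c * poly_eval W x.
Proof.
have [w [C [_ C0 WC]]] := homogeneous_bounds d_gt0
  (@poly_eval_continuous _ _ W) W_scale W_pd.
have /choice [k kP] i : exists k : R, 0 < k /\
    forall x, k * `|x| ^+ d <= - poly_eval (lie_derivative (A i) W) x.
  have evN x : poly_eval (- lie_derivative (A i) W) x =
      - poly_eval (lie_derivative (A i) W) x.
    exact: mpoly.mevalN.
  have [|k [K [k0 _ kP]]] := homogeneous_bounds d_gt0
      (@poly_eval_continuous _ _ (- lie_derivative (A i) W)) _ (@LW_pd i).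
    by move=> l x; rewrite !evN (lie_derivative_scale _ _ _ W_scale) mulrN.
  by exists k; split => // x; have := kP x; rewrite evN => /andP[].
pose c : R := (C * (1 + \sum_i (k i)^-1))^-1.
have s0 : 0 <= \sum_i (k i)^-1 by apply: sumr_ge0 => i _; rewrite invr_ge0 ltW// (kP i).1.
have c0 : 0 < c by rewrite invr_gt0 mulr_gt0// ltr_wpDr.
have ck i : c * C <= k i.
  have [ki _] := kP i.
  rewrite /c invfM mulrAC mulVf ?lt0r_neq0// mul1r -[leRHS]invrK.
  rewrite lef_pV2 ?posrE ?invr_gt0// ?ltr_wpDr//.
  rewrite (bigD1 i)//= addrCA lerDl addr_ge0//.
  by apply: sumr_ge0 => j _; rewrite invr_ge0 ltW// (kP j).1.
exists c => //.
suff hull : convex_hull (range A) `<=`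
    [set M | forall x, poly_eval (lie_derivative M W) x <= - c * poly_eval W x].
  by move=> M /hull.
apply: smallest_sub; last first.
  move=> _ [i _ <-] x; have /andP[_ h1] := WC x.
  have h2 := (kP i).2 x.
  have h3 : c * poly_eval W x <= k i * `|x| ^+ d.
    apply: (@le_trans _ _ (c * (C * `|x| ^+ d))); first by rewrite ler_pM2l.
    by rewrite mulrA ler_wpM2r// exprn_ge0.
  by rewrite mulNr lerNr (le_trans h3).
move=> M N l; rewrite !inE /= => MP NP x.
rewrite -directional_derivative_lie.
have conv (P : 'M[R]_n) (a : R) : P = a *: M + (1 - a) *: N ->
    directional_derivative W x (P *m x) =
    a * directional_derivative W x (M *m x) +
    (1 - a) * directional_derivative W x (N *m x).
  move=> ->; rewrite /directional_derivative !mulr_sumr -big_split /=.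
  apply: eq_bigr => j _; rewrite mulmxDl -!scalemxAl !mxE /=; ring.
rewrite (conv _ l%:num erefl).
rewrite !directional_derivative_lie.
have l0 : 0 <= l%:num :> R by [].
have l1 : l%:num <= 1 :> R by [].
have := ler_wpM2l l0 (MP x); have := ler_wpM2l (_ : 0 <= 1 - l%:num) (NP x).
rewrite subr_ge0 => /(_ l1); lra.
Qed.

(** With V = W (x t), V' <= - c V implies
    ((1 + c t) V)' <= c V - (1 + c t) c V = - c ^ 2 t V <= 0. *)
Lemma trajectory_bound : exists2 c : R, 0 < c & forall x, inclusion_solution A x ->
  forall T, 0 <= T -> (1 + c * T) * poly_eval W (x T) <= poly_eval W (x 0).
Proof.
have [c c0 cP] := decay_rate; exists c => // x [xac xd] T T0.
have [->|Tn0] := eqVneq T 0; first by rewrite mulr0 addr0 mul1r.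
have Tgt0 : 0 < T by rewrite lt_neqAle eq_sym Tn0.
have W0 y : 0 <= poly_eval W y.
  have [->|y0] := eqVneq y 0; last exact/ltW/W_pd.
  by rewrite -[X in poly_eval _ X](scale0r 0) W_scale expr0n gtn_eqF// mul0r.
pose g t := (1 + c * t) * poly_eval W (x t).
suff : g T <= g 0 by rewrite /g mulr0 addr0 mul1r.
apply: (@ac_nonincreasing _ g) => //.
  have /(ac_bounded_poly W (ltW Tgt0)) h1 := xac T Tgt0.
  have h2 : ac_bounded 0 T (fun t : R => 1 + c * t).
    apply: ac_boundedD; first exact: ac_bounded_cst.
    apply: ac_boundedM; [exact: ac_bounded_cst|exact: ac_bounded_id].
  by have [] := ac_boundedM h2 h1.
have [Z [mZ Z0 xZ]] := xd.
exists Z; split => //; apply: subset_trans xZ; apply: subsetC => t /= tP t0 tT.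
have [M MA xM] := tP t0.
have WM := poly_chain_rule W xM; rewrite directional_derivative_lie in WM.
exists (c * poly_eval W (x t) + (1 + c * t) * poly_eval (lie_derivative M W) (x t)).
  have h1 : 0 <= 1 + c * t by rewrite addr_ge0// mulr_ge0// ltW.
  have := ler_wpM2l h1 (cP _ MA (x t)).
  have : 0 <= c * (c * t * poly_eval W (x t)) by rewrite !mulr_ge0// ltW.
  lra.
rewrite [X in is_derive _ _ X _](_ : g =
  (cst 1 + c \*: id) * (fun u => poly_eval W (x u))); last by apply/funext.
apply: is_derive_eq; rewrite /GRing.scale /= (_ : (cst 1 + c \*: id) t = 1 + c * t)//.
ring.
Qed.

Lemma lyapunov_stable : asymptotically_stable A.
Proof.
have [c c0 cP] := trajectory_bound.
have [w [C [w0 C0 WC]]] := homogeneous_bounds d_gt0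
  (@poly_eval_continuous _ _ W) W_scale W_pd.
have small e x T : 0 < e -> inclusion_solution A x -> 0 <= T ->
    C * `|x 0| ^+ d < (1 + c * T) * (w * e ^+ d) -> `|x T| < e.
  move=> e0 Ax T0 h.
  have cT : 0 < 1 + c * T by rewrite ltr_pwDl// mulr_ge0// ltW.
  have /andP[h1 _] := WC (x T); have /andP[_ h2] := WC (x 0).
  have h3 := cP x Ax T T0.
  have : (1 + c * T) * (w * `|x T| ^+ d) < (1 + c * T) * (w * e ^+ d).
    by apply: le_lt_trans h; apply: le_trans (le_trans h3 h2); rewrite ler_pM2l.
  by rewrite !ltr_pM2l// ltr_pXn2r ?nnegrE ?normr_ge0 ?(ltW e0).
split.
  move=> e e0; pose b := e ^+ d * (w / C).
  have b0 : 0 < b by rewrite mulr_gt0 ?exprn_gt0// divr_gt0.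
  exists (Num.min 1 b); first by rewrite lt_min ltr01.
  move=> x Ax; rewrite lt_min => /andP[x1 xb] t t0; apply: (small e x t) => //.
  have h1 : `|x 0| ^+ d <= `|x 0|.
    by rewrite -[leRHS]expr1; apply: ler_wiXn2l => //; exact: ltW.
  apply: (@lt_le_trans _ _ (C * b)); first by rewrite ltr_pM2l// (le_lt_trans h1).
  rewrite (_ : C * b = w * e ^+ d); last by rewrite /b; field; rewrite lt0r_neq0.
  apply: ler_peMl; last by rewrite lerDl mulr_ge0// ltW.
  by apply: mulr_ge0; [exact: ltW|exact/exprn_ge0/ltW].
move=> x Ax; apply/cvgrPdist_lt => e e0.
pose B := C * `|x 0| ^+ d / (w * e ^+ d).
have we : 0 < w * e ^+ d by rewrite mulr_gt0// exprn_gt0.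
near=> t; rewrite sub0r normrN.
have t0 : 0 <= t by near: t; apply: nbhs_pinfty_ge; exact: num_real.
apply: small => //; rewrite -ltr_pdivrMr// -/B -ltrBlDl -ltr_pdivrMl//.
by near: t; apply: nbhs_pinfty_gt; exact: num_real.
Unshelve. all: by end_near. Qed.

End LyapunovStability.

(** * The equivalence *)

(** W is then constant. As soon as there are a variable and a matrix, this
    contradicts the strict decrease of W; so degree 0, for which scaling gives
    no information, is left to degenerate systems. *)
Lemma lie_derivative_degree0 (R : realType) (n : nat) (M : 'M[R]_n)
    (W : mpoly.mpoly n R) : poly_degree W = 0%N -> lie_derivative M W = 0.
Proof.
move=> W0; have -> : W = mpoly.mpolyC n (mpoly.mcoeff mpoly.mnm0 W).
  apply: mpoly.msize1_polyC; move: W0; rewrite /poly_degree.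
  by case: mpoly.mmeasure => // -[].
by rewrite /lie_derivative big1// => j _; rewrite mpoly.mderivC mul0r.
Qed.

Theorem theorem3p7 (R : realType) (n m : nat) (A : 'I_m -> 'M[R]_n) :
  asymptotically_stable A <->
  exists W : mpoly.mpoly n R,
    [/\ homogeneous W,
        sum_of_squares W,
        positive_definite W &
        forall i : 'I_m,
          sum_of_squares (- lie_derivative (A i) W) /\
          positive_definite (- lie_derivative (A i) W)].
Proof.
split=> [|[W [Wh _ Wpd LW]]]; first exact: common_polynomial_of_stable.
have LWpd i := (LW i).2.
have [d0|d_gt0] := posnP (poly_degree W); last exact: (lyapunov_stable d_gt0).
(* Without variables, every polynomial is positive definite, and 0 scales with
   any degree. *)
case: n => [|n] in A W Wh Wpd LW LWpd d0 *.
  have triv (x : 'cV[R]_0) : x = 0 by apply/colP => -[].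
  apply: (@lyapunov_stable R 0 m A 0 1) => //.
  - by move=> l x; rewrite /poly_eval !mpoly.meval0 mulr0.
  - by move=> x; rewrite [x]triv eqxx.
  - by move=> i x; rewrite [x]triv eqxx.
(* Without matrices, W may be constant and is replaced by the squared norm. *)
case: m => [|m] in A LW LWpd *.
  pose V : mpoly.mpoly n.+1 R := \sum_k mpoly.mpolyX R (mpoly.mnm1 k) ^+ 2.
  have VE x : poly_eval V x = \sum_k x k ord0 ^+ 2.
    rewrite /poly_eval raddf_sum; apply: eq_bigr => k _ /=.
    by rewrite rmorphXn /= mpoly.mevalXU.
  apply: (@lyapunov_stable R n.+1 0 A V 2) => //; last by case.
  - move=> l x; rewrite !VE mulr_sumr; apply: eq_bigr => k _.
    by rewrite mxE exprMn.
  - move=> x x0; rewrite VE lt_neqAle eq_sym sumr_ge0 ?andbT => [|k _];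
      last exact: sqr_ge0.
    apply: contra x0 => /eqP/psumr_eq0P x0; apply/eqP/colP => k; rewrite mxE.
    by apply/eqP; rewrite -sqrf_eq0 x0// => j _; exact: sqr_ge0.
exfalso; have /(_ ord0 (const_mx 1)) := LWpd.
rewrite lie_derivative_degree0// oppr0 /poly_eval mpoly.meval0 ltxx.
have c1 : const_mx 1 != 0 :> 'cV[R]_n.+1.
  by apply/eqP => /colP/(_ ord0)/eqP; rewrite !mxE oner_eq0.
by move=> /(_ c1).
Qed.
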